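(* Let $(M,J,\Omega)$ be a compact $p$-Kähler manifold of complex dimension $n$, with $1<p<n-1$, and let $\{M_t\}_{t\in I}$ be a differentiable family of compact complex manifolds, where $I=(-\epsilon,\epsilon)$, $\epsilon>0$, and $M_0=(M,J)$. Suppose that $\{M_t\}_{t\in I}$ is parametrized by the $(0,1)$-vector form $\varphi(t)\in\mathcal{A}^{0,1}(T^{1,0}M)$. If there exists a smooth family $\{\Omega_t\}_{t\in I}$ of $p$-Kähler structures along $\{M_t\}_{t\in I}$ (each $\Omega_t$ being a $p$-Kähler structure on $M_t$) such that $\Omega_0=\Omega$, then $$\Big[\partial\big(\iota_{\varphi'(0)}(\Omega)\big)\Big]_{H^{p,p+1}_{\overline{\partial}}(M)}=0,$$ i.e. the $(p,p+1)$-form $\partial(\iota_{\varphi'(0)}(\Omega))$ represents the zero class in the Dolbeault cohomology group $H^{p,p+1}_{\overline{\partial}}(M)$ of $(M,J)$.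
   Context: $p$-Kähler structures. Let $\sigma_{q}=i^{q^{2}}2^{-q}$. At a point $x$ of a complex manifold of complex dimension $n$, given a basis $\{\varphi^1,\dots,\varphi^n\}$ of $(1,0)$-covectors, put $\mathrm{Vol}=(\tfrac{i}{2}\varphi^1\wedge\overline{\varphi}^1)\wedge\dots\wedge(\tfrac{i}{2}\varphi^n\wedge\overline{\varphi}^n)$; a real $(n,n)$-form at $x$ is strictly positive if it is a positive multiple of $\mathrm{Vol}$. A $(q,0)$-covector is simple if it is a wedge product of $q$ $(1,0)$-covectors. A real $(p,p)$-form $\Omega$ is transverse if at every point $\sigma_{n-p}\,\Omega\wedge\beta\wedge\overline{\beta}$ is strictly positive for every nonzero simple $(n-p,0)$-covector $\beta$. A $p$-Kähler structure is a smooth real transverse $(p,p)$-form with $d\Omega=0$; $(M,J,\Omega)$ is then called a $p$-Kähler manifold. Deformations. A differentiable family of compact complex manifolds $\{M_t\}_{t\in I}$ is given by a differentiable manifold $\mathfrak{M}$ and a differentiable proper map $\pi:\mathfrak{M}\to I$ whose Jacobian has constant rank equal to $\dim I=1$, with $\pi^{-1}(t)=M_t$ as complex manifolds. All $M_t$ are diffeomorphic, so one regards $M_t$ as the fixed smooth manifold $M$ with a complex structure $J_t$, $J_0=J$. $\mathcal{A}^{p,q}(M)$ denotes smooth $(p,q)$-forms on $(M,J)$ and $\mathcal{A}^{0,1}(T^{1,0}M)$ the smooth $T^{1,0}M$-valued $(0,1)$-forms. The family is parametrized by $\varphi(t)\in\mathcal{A}^{0,1}(T^{1,0}M)$ (depending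 smoothly on $t$, $\varphi(0)=0$, satisfying the Maurer–Cartan equation $\overline{\partial}\varphi(t)=\tfrac12[\varphi(t),\varphi(t)]$), which means: writing locally $\varphi(t)=\sum_{\lambda}\varphi^{\lambda}(t)\otimes\frac{\partial}{\partial z^{\lambda}}$ in local holomorphic coordinates of $(M,J)$, a differentiable function $f$ on an open subset of $M$ is holomorphic for $M_t$ if and only if $\big(\overline{\partial}-\sum_\lambda\varphi^{\lambda}(t)\frac{\partial}{\partial z^{\lambda}}\big)f=0$. $\varphi'(0)$ is the derivative of $\varphi(t)$ at $t=0$. Contraction. For a vector form $\phi=\eta\otimes Z$, with $\eta\in\mathcal{A}^{0,s}(M)$ and $Z$ a section of $T^{1,0}M$, set $\iota_\phi(\sigma)=\eta\wedge(\iota_Z\sigma)$, extended linearly, so that $\iota_\phi:\mathcal{A}^{p,q}(M)\to\mathcal{A}^{p-1,q+s}(M)$. The operator $\partial$ is that of $(M,J)$. A smooth family of $(p,p)$-forms along $\{M_t\}$ is a family $\Omega_t\in\mathcal{A}^{p,p}(M_t)$ which, as forms on the underlying manifold $M$, depends smoothly on $t$. *)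

(* Defs.v *)
From HB Require Import structures.
From mathcomp Require Import all_boot all_order all_algebra all_fingroup.
From mathcomp Require Import complex.
From mathcomp Require Import all_classical all_reals all_analysis.

Set Implicit Arguments.
Unset Strict Implicit.
Unset Printing Implicit Defensive.

Import Order.TTheory GRing.Theory Num.Theory.
Import numFieldNormedType.Exports.

Local Open Scope ring_scope.
Local Open Scope classical_set_scope.
Local Open Scope complex_scope.

(* A covector of degree [k] on R^m is a complex-valued alternating
   multilinear function of [k] vectors of the complexification C^m, given as
   the rows of a matrix. *)

Section Covectors.
Context {R : realType}.
Implicit Types m k l p q : nat.

Definition covector m k := 'M[R[i]]_(k, m) -> R[i].

Definition alt_multilinear m k (a : covector m k) : Prop :=
  (forall (i : 'I_k) (u v w : 'M[R[i]]_(k, m)) (x y : R[i]),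
      row i u = x *: row i v + y *: row i w ->
      row' i v = row' i u -> row' i w = row' i u ->
      a u = x * a v + y * a w) /\
  (forall (i j : 'I_k) (v : 'M[R[i]]_(k, m)),
      i != j -> row i v = row j v -> a v = 0).

Definition scale_covector m k (x : R[i]) (a : covector m k) : covector m k :=
  fun v => x * a v.

(* Normalized so that (dx^1 /\ dx^2)(e_1, e_2) = 1. *)
Definition wedge_prod m k l (a : covector m k) (b : covector m l) :
    covector m (k + l) :=
  fun v => (k`! * l`!)%:R^-1 *
    \sum_(s : 'S_(k + l)) (-1) ^+ odd_perm s *
      (a (usubmx (row_perm s v)) * b (dsubmx (row_perm s v))).

Fixpoint wedges m d q : ('I_q -> covector m d) -> covector m (q * d) :=
  match q with
  | 0 => fun _ _ => 1
  | q'.+1 => fun b => wedge_prod (b ord0) (wedges (fun i => b (lift ord0 i)))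
  end.

Definition conj_covector m k (a : covector m k) : covector m k :=
  fun v => (a (map_mx (@conjc R) v))^*.

Definition real_covector m k (a : covector m k) : Prop :=
  forall v, conj_covector a v = a v.

Definition interior_prod m k (Z : 'rV[R[i]]_m) (a : covector m k.+1) :
    covector m k :=
  fun v => a (col_mx Z v).

(* A complex structure is given by its space [H] of (1,0)-vectors in C^m; the
   (0,1)-vectors are the conjugates of these. *)

Definition of_type m (H : set 'rV[R[i]]_m) p q k (a : covector m k) : Prop :=
  [/\ k = (p + q)%N, alt_multilinear a &
      forall (S : {set 'I_k}) (v : 'M[R[i]]_(k, m)),
        (forall i, i \in S -> H (row i v)) ->
        (forall i, i \notin S -> H (map_mx (@conjc R) (row i v))) ->
        #|S| != p -> a v = 0].

Definition basis10 m (H : set 'rV[R[i]]_m) n (f : 'I_n -> covector m 1) :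
    Prop :=
  (forall j, of_type H 1 0 (f j)) /\
  (forall a : covector m 1, of_type H 1 0 a ->
    exists! x : 'rV[R[i]]_n, forall v, a v = \sum_j x 0 j * f j v).

Definition Vol m n (f : 'I_n -> covector m 1) : covector m (n * 2) :=
  wedges (fun j =>
    scale_covector ('i / 2%:R) (wedge_prod (f j) (conj_covector (f j)))).

(* The degree [k] is propositionally, not definitionally, equal to [n * 2]. *)
Definition strictly_positive m (H : set 'rV[R[i]]_m) n k (a : covector m k) :
    Prop :=
  exists (f : 'I_n -> covector m 1) (e : (n * 2)%N = k) (c : R),
    [/\ basis10 H f, 0 < c &
        forall v, a (castmx (e, erefl m) v) = c%:C * Vol f v].

Definition sigma_const q : R[i] := 'i ^+ (q ^ 2) * 2%:R ^- q.

Definition transverse_covector m (H : set 'rV[R[i]]_m) n p k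
    (a : covector m k) : Prop :=
  forall b : 'I_(n - p) -> covector m 1,
    (forall j, of_type H 1 0 (b j)) ->
    (exists v, wedges b v != 0) ->
    strictly_positive H n
      (scale_covector (sigma_const (n - p))
         (wedge_prod (wedge_prod a (wedges b)) (conj_covector (wedges b)))).

End Covectors.

Arguments covector R m k : clear implicits.

Section Calculus.
Context {R : realType}.
Implicit Types m k : nat.

(* On an open set this is C^oo: all iterated partial derivatives exist and are
   Frechet differentiable. *)
Definition smooth_on m (W : normedModType R) (U : set 'rV[R]_m)
    (f : 'rV[R]_m -> W) : Prop :=
  forall (s : seq 'I_m) x, U x ->
    differentiable (foldr (fun i g => 'D_('e_i) g) f s) x.

Definition Csmooth_on m (U : set 'rV[R]_m) (f : 'rV[R]_m -> R[i]) : Prop :=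
  smooth_on U (fun x => complex.Re (f x) : R) /\
  smooth_on U (fun x => complex.Im (f x) : R).

(* Joint smoothness in (t, x) on ]-eps, eps[ * U. *)
Definition Csmooth_family m (eps : R) (U : set 'rV[R]_m)
    (F : R -> 'rV[R]_m -> R[i]) : Prop :=
  Csmooth_on
    [set y : 'rV[R]_(1 + m) |
       `]- eps, eps[%classic (lsubmx y 0 0) /\ U (rsubmx y)]
    (fun y => F (lsubmx y 0 0) (rsubmx y)).

Definition Cderiv (f : R -> R[i]) (t : R) : R[i] :=
  (fun s => complex.Re (f s) : R)^`() t +i*
  (fun s => complex.Im (f s) : R)^`() t.

Definition Cpartial m (j : 'I_m) (f : 'rV[R]_m -> R[i]) (x : 'rV[R]_m) : R[i] :=
  'D_('e_j) (fun y => complex.Re (f y) : R) x +i*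
  'D_('e_j) (fun y => complex.Im (f y) : R) x.

Definition ext_d m k (w : 'rV[R]_m -> covector R m k) :
    'rV[R]_m -> covector R m (1 + k) :=
  fun x v => \sum_j wedge_prod (fun u : 'rV[R[i]]_m => u 0 j)
                          (fun u => Cpartial j (fun y => w y u) x) v.

(* C^n is R^(n + n), with the coordinates x^1, .., x^n, y^1, .., y^n, where
   z^j = x^j + i y^j. *)

Section ComplexCoordinates.
Variable n : nat.
Implicit Types (j : 'I_n) (x : 'rV[R]_(n + n)).

Definition zcoord j x : R[i] := x 0 (lshift n j) +i* x 0 (rshift n j).

Definition dz j : covector R (n + n) 1 :=
  fun v => v 0 (lshift n j) + 'i * v 0 (rshift n j).

Definition dzbar j : covector R (n + n) 1 :=
  fun v => v 0 (lshift n j) - 'i * v 0 (rshift n j).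

Definition d_dz j : 'rV[R[i]]_(n + n) :=
  2%:R^-1 *: ('e_(lshift n j) - 'i *: 'e_(rshift n j)).

Definition std10 : set 'rV[R[i]]_(n + n) :=
  [set v | exists a : 'I_n -> R[i], v = \sum_j a j *: d_dz j].

(* d/dx^j |-> d/dy^j and d/dy^j |-> - d/dx^j, acting on row vectors. *)
Definition std_J : 'M[R]_(n + n) := block_mx 0 1%:M (- 1%:M) 0.

Definition z_partial j (f : 'rV[R]_(n + n) -> R[i]) x : R[i] :=
  2%:R^-1 * (Cpartial (lshift n j) f x - 'i * Cpartial (rshift n j) f x).

Definition zbar_partial j (f : 'rV[R]_(n + n) -> R[i]) x : R[i] :=
  2%:R^-1 * (Cpartial (lshift n j) f x + 'i * Cpartial (rshift n j) f x).

Definition del k (w : 'rV[R]_(n + n) -> covector R (n + n) k) :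
    'rV[R]_(n + n) -> covector R (n + n) (1 + k) :=
  fun x v =>
    \sum_j wedge_prod (dz j) (fun u => z_partial j (fun y => w y u) x) v.

Definition delbar k (w : 'rV[R]_(n + n) -> covector R (n + n) k) :
    'rV[R]_(n + n) -> covector R (n + n) (1 + k) :=
  fun x v =>
    \sum_j wedge_prod (dzbar j) (fun u => zbar_partial j (fun y => w y u) x) v.

Definition holomorphic_on (U : set 'rV[R]_(n + n))
    (f : 'rV[R]_(n + n) -> R[i]) : Prop :=
  Csmooth_on U f /\ (forall x j, U x -> zbar_partial j f x = 0).

(* A vector form sum_l f^l (x) d/dz^l is given by the 1-forms f^l; its
   contraction sum_l f^l /\ i_(d/dz^l) preserves the degree. *)

Definition contract_form k (f : 'I_n -> covector R (n + n) 1) :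
    covector R (n + n) k -> covector R (n + n) k :=
  match k with
  | 0 => fun _ _ => 0
  | k'.+1 => fun a v => \sum_l wedge_prod (f l) (interior_prod (d_dz l) a) v
  end.

(* The bracket of two vector (0,1)-forms; the sign (-1)^(1 * 1) turns the usual
   difference into a sum. *)
Definition bracket (f g : 'rV[R]_(n + n) -> 'I_n -> covector R (n + n) 1) :
    'rV[R]_(n + n) -> 'I_n -> covector R (n + n) (1 + 1) :=
  fun x l v => \sum_j
    (wedge_prod (f x j) (fun u => z_partial j (fun y => g y l u) x) v +
     wedge_prod (g x j) (fun u => z_partial j (fun y => f y l u) x) v).

Definition maurer_cartan_on (U : set 'rV[R]_(n + n))
    (f : 'rV[R]_(n + n) -> 'I_n -> covector R (n + n) 1) : Prop :=
  forall x l v, U x ->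
    delbar (fun y => f y l) x v = 2%:R^-1 * bracket f f x l v.

End ComplexCoordinates.
End Calculus.

(* [chart_bwd] is only meaningful on the image of [chart_dom]. *)
Record chart (R : realType) (M : Type) (m : nat) := Chart {
  chart_dom : set M;
  chart_fwd : M -> 'rV[R]_m;
  chart_bwd : 'rV[R]_m -> M }.

Section Manifolds.
Context {R : realType} {M : topologicalType}.

Section Charts.
Context {m : nat}.
Implicit Types (c d : chart R M m) (U : set M).

Definition chart_img c U : set 'rV[R]_m := chart_fwd c @` (chart_dom c `&` U).

Definition is_chart c : Prop :=
  [/\ open (chart_dom c), open (chart_img c setT),
      (forall x, chart_dom c x -> chart_bwd c (chart_fwd c x) = x),
      {within chart_dom c, continuous (chart_fwd c)} &
      {within chart_img c setT, continuous (chart_bwd c)}].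

Definition transition c d : 'rV[R]_m -> 'rV[R]_m :=
  chart_fwd d \o chart_bwd c.

Definition overlap c d : set 'rV[R]_m := chart_img c (chart_dom d).

Definition smooth_transition c d : Prop :=
  smooth_on (overlap c d) (transition c d).

(* Pushforward of a complexified tangent vector under a change of charts. *)
Definition pushforward_chart c d (x : 'rV[R]_m) k (v : 'M[R[i]]_(k, m)) :
    'M[R[i]]_(k, m) :=
  v *m map_mx (real_complex R) ('J (transition c d) x).

End Charts.

Section ComplexAtlas.
Context {n : nat}.
Notation cchart := (chart R M (n + n)).
Notation atlas := (set cchart).
Implicit Types (A B : atlas) (c d : cchart).

Definition holomorphic_transition c d : Prop :=
  smooth_transition c d /\
  (forall x j k, overlap c d x ->
     zbar_partial j (fun y => zcoord k (transition c d y)) x = 0).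

Definition complex_atlas A : Prop :=
  [/\ forall c, A c -> is_chart c,
      forall x, exists2 c, A c & chart_dom c x &
      forall c d, A c -> A d -> holomorphic_transition c d].

Definition complex_manifold A : Prop :=
  [/\ hausdorff_space M, @second_countable M & complex_atlas A].

(* [A] and [B] have the same underlying smooth manifold. *)
Definition smoothly_compatible A B : Prop :=
  forall c d, A c -> B d -> smooth_transition c d /\ smooth_transition d c.

Definition smooth_fun A (U : set M) (f : M -> R[i]) : Prop :=
  forall c, A c -> Csmooth_on (chart_img c U) (f \o chart_bwd c).

Definition holomorphic_fun A (U : set M) (f : M -> R[i]) : Prop :=
  forall c, A c -> holomorphic_on (chart_img c U) (f \o chart_bwd c).

(* The (1,0)-vectors of the complex structure [B], at the point with
   coordinates [x], expressed in the coordinates of [c] (a chart which need not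
   be holomorphic for [B]). *)
Definition T10 B c (x : 'rV[R]_(n + n)) : set 'rV[R[i]]_(n + n) :=
  [set v | forall d, B d -> overlap c d x -> std10 (pushforward_chart c d x v)].

(* A form is the family of its local expressions in the charts of an atlas;
   the local expression in a chart only matters on the image of the chart. *)

Definition dform k := cchart -> 'rV[R]_(n + n) -> covector R (n + n) k.

Definition form_eq A k (w w' : dform k) : Prop :=
  forall c x v, A c -> chart_img c setT x -> w c x v = w' c x v.

Definition smooth_form A k (w : dform k) : Prop :=
  [/\ forall c x, A c -> chart_img c setT x -> alt_multilinear (w c x),
      forall c v, A c -> Csmooth_on (chart_img c setT) (fun x => w c x v) &
      forall c d x v, A c -> A d -> overlap c d x ->
        w c x v = w d (transition c d x) (pushforward_chart c d x v)].

(* From here to [p_kahler], the form is given in the charts of [A], and [B] is a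
   complex structure on the same smooth manifold. *)
Definition form_of_type A B p q k (w : dform k) : Prop :=
  smooth_form A w /\
  (forall c x, A c -> chart_img c setT x -> of_type (T10 B c x) p q (w c x)).

Definition real_form A k (w : dform k) : Prop :=
  forall c x, A c -> chart_img c setT x -> real_covector (w c x).

Definition closed_form A k (w : dform k) : Prop :=
  forall c x v, A c -> chart_img c setT x -> ext_d (w c) x v = 0.

Definition transverse_form A B p (w : dform (p + p)) : Prop :=
  forall c x, A c -> chart_img c setT x ->
    transverse_covector (T10 B c x) n p (w c x).

Definition p_kahler A B p (w : dform (p + p)) : Prop :=
  [/\ form_of_type A B p p w, real_form A w, closed_form A w &
      transverse_form A B w].

(* The class of [w] in H^{p,q+1} (for the Dolbeault operator of [A]), as a
   coset: the set of cocycles differing from [w] by a coboundary. *)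
Definition dolbeault_class A p q k (w : dform (1 + k)) : set (dform (1 + k)) :=
  [set a | [/\ form_of_type A A p q.+1 a,
               form_eq A (fun c => delbar (a c)) (fun _ _ _ => 0) &
               exists2 b : dform k, form_of_type A A p q b &
                 form_eq A (fun c x v => w c x v - a c x v)
                           (fun c => delbar (b c))]].

(* In a chart of a complex atlas, the family of the (0,1)-forms f^l in
   sum_l f^l (x) d/dz^l. *)

Definition vform := cchart -> 'rV[R]_(n + n) -> 'I_n -> covector R (n + n) 1.

Definition vector_form A (f : vform) : Prop :=
  [/\ forall c x l, A c -> chart_img c setT x ->
        of_type (@std10 R n) 0 1 (f c x l),
      forall c l v, A c -> Csmooth_on (chart_img c setT) (fun x => f c x l v) &
      forall c d x v k, A c -> A d -> overlap c d x ->
        \sum_l f c x l v *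
          z_partial l (fun y => zcoord k (transition c d y)) x =
        f d (transition c d x) k (pushforward_chart c d x v)].

(* The total space of a differentiable family over ]-eps, eps[ is
   diffeomorphic over ]-eps, eps[ to M * ]-eps, eps[; thus a family amounts to
   complex structures [Jt t] on the smooth manifold underlying [J], whose
   almost complex structure tensors depend smoothly on (t, x). *)

Definition differentiable_family J (eps : R) (Jt : R -> atlas) : Prop :=
  [/\ forall t, `]- eps, eps[%classic t -> complex_manifold (Jt t),
      forall t, `]- eps, eps[%classic t -> smoothly_compatible J (Jt t) &
      exists acs : R -> cchart -> 'rV[R]_(n + n) -> 'M[R]_(n + n),
        (forall c i j, J c ->
           Csmooth_family eps (chart_img c setT)
             (fun t x => (acs t c x i j)%:C)) /\
        (forall t c d x, `]- eps, eps[%classic t -> J c -> Jt t d ->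
           overlap c d x ->
           acs t c x *m 'J (transition c d) x =
           'J (transition c d) x *m std_J n)].

Definition parametrizes J (eps : R) (Jt : R -> atlas) (phi : R -> vform) :
    Prop :=
  [/\ forall t, `]- eps, eps[%classic t -> vector_form J (phi t),
      forall c l v, J c ->
        Csmooth_family eps (chart_img c setT) (fun t x => phi t c x l v),
      forall c x l v, J c -> chart_img c setT x -> phi 0 c x l v = 0,
      forall t c, `]- eps, eps[%classic t -> J c ->
        maurer_cartan_on (chart_img c setT) (phi t c) &
      forall t (U : set M) (f : M -> R[i]), `]- eps, eps[%classic t ->
        open U -> smooth_fun J U f ->
        (holomorphic_fun (Jt t) U f <->
         forall c x v, J c -> chart_img c U x ->
           \sum_l dzbar l v * zbar_partial l (f \o chart_bwd c) x -
           \sum_l phi t c x l v * z_partial l (f \o chart_bwd c) x = 0)].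

Definition vform_deriv (phi : R -> vform) (t : R) : vform :=
  fun c x l v => Cderiv (fun s => phi s c x l v) t.

Definition smooth_form_family J (eps : R) k (w : R -> dform k) : Prop :=
  (forall t, `]- eps, eps[%classic t -> smooth_form J (w t)) /\
  (forall c v, J c ->
     Csmooth_family eps (chart_img c setT) (fun t x => w t c x v)).

End ComplexAtlas.
End Manifolds.

(* Main.v *)
Require Import Defs.
From mathcomp Require Import all_boot all_order all_algebra all_fingroup.
From mathcomp Require Import complex ring lra.
From mathcomp Require Import all_classical all_reals all_analysis.

Set Implicit Arguments.
Unset Strict Implicit.
Unset Printing Implicit Defensive.

Import Order.TTheory GRing.Theory Num.Theory.
Import numFieldNormedType.Exports.

Local Open Scope ring_scope.
Local Open Scope classical_set_scope.
Local Open Scope complex_scope.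

(** Let w be the derivative at t = 0 of the forms Omega_t. The exterior
    derivative commutes with the derivative in t, because mixed second
    derivatives commute ([mixed_derivatives_eq]); hence dw = 0
    ([closed_form_deriv]). Although each Omega_t has type (p,p) for its own
    complex structure, w need not have type (p,p) for the structure J at t = 0,
    and its component of type (p-1,p+1) is the contraction of Omega with
    phi'(0). Indeed the (0,1)-vectors of the structure at time t are the
    u - phi(t)(u), for u of type (0,1) at time 0 ([T10_graph]). So Omega_t
    vanishes on such vectors and their conjugates unless p of them are of type
    (1,0). Differentiating this at t = 0, on p - 1 vectors of type (1,0) and
    p + 1 of type (0,1), the product rule leaves w minus the terms in which a
    (0,1)-vector u is replaced by phi'(0)(u), and these make up the contraction
    ([contraction_is_variation]). The component of type (p,p+1) of dw = 0 now
    reads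

      del (contraction of Omega with phi'(0)) + delbar (component (p,p) of w) = 0,

    so that the class in question is that of a coboundary
    ([del_contract_form]).

    The components of w are not cut out by hand. Let R_z multiply the
    (1,0)-vectors by z and fix the (0,1)-vectors ([scale10]). The pullback of a
    form by R_z multiplies its component of type (s,k-s) by the s-th power of z.
    With weights c_j such that the sum of the c_j j^s is 1 for s = p and 0 for
    every other s <= 2p+1 ([interpolation_weights]), the component of type (p,p)
    of w is the sum of the c_j R_j^* w, and that of type (p-1,p+1) is the sum of
    the c_j j R_j^* w ([contraction_eq_component]). In this form smoothness,
    alternation and the behaviour under holomorphic changes of charts are
    inherited from w. Moreover, as R_z^* dz = z dz and R_z^* dzbar = dzbar, del
    of the second sum plus delbar of the first one is the sum of the
    c_j R_j^* (dw), which vanishes ([del_pullback], [delbar_pullback]). *)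

(** * Multilinear functions of the rows of a matrix *)

Section Multilinear.
Context {R : realType}.
Implicit Types m k : nat.

Definition set_row m k (i : 'I_k) (u : 'rV[R[i]]_m) (v : 'M[R[i]]_(k, m)) :
    'M[R[i]]_(k, m) :=
  \matrix_(j, l) if j == i then u 0 l else v j l.

Lemma row_set_row m k (i : 'I_k) (u : 'rV[R[i]]_m) (v : 'M[R[i]]_(k, m)) :
  row i (set_row i u v) = u.
Proof. by apply/rowP => l; rewrite !mxE eqxx. Qed.

Lemma row_set_row_neq m k (i j : 'I_k) (u : 'rV[R[i]]_m) (v : 'M[R[i]]_(k, m)) :
  j != i -> row j (set_row i u v) = row j v.
Proof. by move=> /negbTE ji; apply/rowP => l; rewrite !mxE ji. Qed.

Lemma row'_set_row m k (i : 'I_k) (u : 'rV[R[i]]_m) (v : 'M[R[i]]_(k, m)) :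
  row' i (set_row i u v) = row' i v.
Proof.
by apply/matrixP => j l; rewrite !mxE eq_sym (negbTE (neq_lift _ _)).
Qed.

Lemma set_row_id m k (i : 'I_k) (v : 'M[R[i]]_(k, m)) :
  set_row i (row i v) v = v.
Proof. by apply/matrixP => j l; rewrite !mxE; case: eqP => [->|]. Qed.

Lemma set_row_set_row m k (i : 'I_k) (u w : 'rV[R[i]]_m) (v : 'M[R[i]]_(k, m)) :
  set_row i u (set_row i w v) = set_row i u v.
Proof. by apply/matrixP => j l; rewrite !mxE; case: eqP. Qed.

Lemma set_rowC m k (i j : 'I_k) (u w : 'rV[R[i]]_m) (v : 'M[R[i]]_(k, m)) :
  i != j -> set_row i u (set_row j w v) = set_row j w (set_row i u v).
Proof.
move=> ij; apply/matrixP => r l; rewrite !mxE; case: eqP => [->|//].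
by rewrite (negbTE ij).
Qed.

(** Linearity in each row as in [alt_multilinear], with the modified row put in
    place by [set_row]. *)
Definition multilinear m k (a : covector R m k) : Prop :=
  forall i (u w : 'rV[R[i]]_m) (v : 'M[R[i]]_(k, m)) (x y : R[i]),
    a (set_row i (x *: u + y *: w) v) =
    x * a (set_row i u v) + y * a (set_row i w v).

Lemma alt_multilinearP m k (a : covector R m k) :
  alt_multilinear a <->
  multilinear a /\
  (forall (i j : 'I_k) v, i != j -> row i v = row j v -> a v = 0).
Proof.
split=> -[lin alt]; split=> //.
- move=> i u w v x y; apply: (lin i); rewrite ?row_set_row ?row'_set_row //.
- move=> i u v w x y uE vu wu.
  have E z : row' i z = row' i u -> z = set_row i (row i z) u.
    move=> zu; apply/matrixP => j l; rewrite !mxE.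
    case: (unliftP i j) => [j' ->|->]; last by rewrite eqxx.
    rewrite eq_sym (negbTE (neq_lift _ _)).
    by move/matrixP/(_ j' l): zu; rewrite !mxE.
  by rewrite (E u) // (E v) // (E w) // uE lin.
Qed.

Lemma multilinear_sum m k (a : covector R m k) i (v : 'M[R[i]]_(k, m))
    (I : finType) (x : I -> R[i]) (u : I -> 'rV[R[i]]_m) :
  multilinear a ->
  a (set_row i (\sum_j x j *: u j) v) = \sum_j x j * a (set_row i (u j) v).
Proof.
move=> lin; have := lin i 0 0 v 0 0; rewrite scaler0 addr0 !mul0r addr0 => a0.
elim/big_rec2: _ => // j y w _ <-.
by have := lin i (u j) w v (x j) 1; rewrite scale1r mul1r => ->.
Qed.

Lemma multilinearZ m k (a : covector R m k) i x u (v : 'M[R[i]]_(k, m)) :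
  multilinear a -> a (set_row i (x *: u) v) = x * a (set_row i u v).
Proof.
by move=> lin; have := lin i u 0 v x 0; rewrite scaler0 addr0 mul0r addr0.
Qed.

Lemma multilinear0 m k (a : covector R m k) i (v : 'M[R[i]]_(k, m)) :
  multilinear a -> a (set_row i 0 v) = 0.
Proof.
by move=> lin; have := multilinearZ i 0 0 v lin; rewrite scaler0 mul0r.
Qed.

(** Splitting one row at a time into two summands in [P] reduces an arbitrary
    argument to those whose rows all lie in [P]. *)
Lemma multilinear_ext m k (a b : covector R m k) (P : set 'rV[R[i]]_m) :
  multilinear a -> multilinear b ->
  (forall u, exists u1 u2, [/\ P u1, P u2 & u = u1 + u2]) ->
  (forall v, (forall i, P (row i v)) -> a v = b v) -> a = b.
Proof.
move=> lina linb dec ab; apply/funext => v.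
suff H r : (r <= k)%N ->
    forall v, (forall i : 'I_k, (r <= i)%N -> P (row i v)) -> a v = b v.
  by apply: (H k) => // i; rewrite leqNgt ltn_ord.
elim: r => [_ {}v Pv|r IH rk {}v Pv]; first by apply: ab => i; apply: Pv.
pose i := Ordinal rk; have [u1 [u2 [P1 P2 uE]]] := dec (row i v).
have Pi u : P u -> forall j : 'I_k, (r <= j)%N -> P (row j (set_row i u v)).
  move=> Pu j rj; have [->|ji] := eqVneq j i; first by rewrite row_set_row.
  rewrite row_set_row_neq //; apply: Pv; rewrite ltn_neqAle rj andbT.
  by apply: contra ji => /eqP rE; apply/eqP/val_inj.
rewrite -(set_row_id i v) uE.
have := lina i u1 u2 v 1 1; have := linb i u1 u2 v 1 1.
rewrite !scale1r !mul1r => -> ->.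
by rewrite !(IH (ltnW rk) _ (Pi _ _)).
Qed.

(** The factors are pulled out one row at a time: at stage [r] they are 1 from
    the row [r] on. *)
Lemma multilinear_scale_rows m k (a : covector R m k) (d : 'I_k -> R[i])
    (u v : 'M[R[i]]_(k, m)) :
  multilinear a -> (forall i, row i u = d i *: row i v) ->
  a u = (\prod_i d i) * a v.
Proof.
move=> lin uE.
suff H r : (r <= k)%N -> forall (e : 'I_k -> R[i]) w,
    (forall i : 'I_k, row i w = e i *: row i v) ->
    (forall i : 'I_k, (r <= i)%N -> e i = 1) -> a w = (\prod_i e i) * a v.
  by apply: (H k) => // i; rewrite leqNgt ltn_ord.
elim: r => [_ e w wE e1|r IH rk e w wE e1].
  rewrite big1 => [|i _]; last exact: e1.
  by rewrite mul1r; congr a; apply/row_matrixP => i; rewrite wE e1 // scale1r.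
pose i := Ordinal rk; pose e' j := if j == i then 1 else e j.
rewrite -(set_row_id i w) wE multilinearZ // (IH (ltnW rk) e').
- rewrite (bigD1 i) //= mulrA [in RHS](bigD1 i) //= /e' eqxx mul1r.
  by congr (_ * _ * _); apply: eq_bigr => j /negbTE ->.
- move=> j; rewrite /e'; case: eqP => [->|/eqP ji].
    by rewrite row_set_row scale1r.
  by rewrite row_set_row_neq.
- move=> j rj; rewrite /e'; case: eqP => [//|/eqP ji].
  apply: e1; rewrite ltn_neqAle rj andbT.
  by apply: contra ji => /eqP rE; apply/eqP/val_inj.
Qed.

Lemma multilinear_mulmx m k (a : covector R m k) (A : 'M[R[i]]_m) :
  multilinear a -> multilinear (fun v => a (v *m A)).
Proof.
move=> lin i u w v x y.
have E z : set_row i z v *m A = set_row i (z *m A) (v *m A).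
  apply/row_matrixP => j; have [->|ji] := eqVneq j i.
    by rewrite row_mul !row_set_row.
  by rewrite row_mul !row_set_row_neq // row_mul.
by rewrite !E mulmxDl -!scalemxAl lin.
Qed.

Lemma alt_multilinear_mulmx m k (a : covector R m k) (A : 'M[R[i]]_m) :
  alt_multilinear a -> alt_multilinear (fun v => a (v *m A)).
Proof.
move=> /alt_multilinearP[lin alt]; apply/alt_multilinearP; split.
  exact: multilinear_mulmx.
by move=> i j v ij vE; apply: (alt i j) => //; rewrite !row_mul vE.
Qed.

Lemma multilinear_lincomb m k (I : finType) (e : I -> R[i])
    (a : I -> covector R m k) :
  (forall j, multilinear (a j)) -> multilinear (fun v => \sum_j e j * a j v).
Proof.
move=> lin i u w v x y; rewrite !mulr_sumr -big_split /=.
by apply: eq_bigr => j _; rewrite lin; ring.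
Qed.

Lemma alt_multilinear_lincomb m k (I : finType) (e : I -> R[i])
    (a : I -> covector R m k) :
  (forall j, alt_multilinear (a j)) ->
  alt_multilinear (fun v => \sum_j e j * a j v).
Proof.
move=> alt; apply/alt_multilinearP; split.
  by apply: multilinear_lincomb => j; case/alt_multilinearP: (alt j).
move=> i j v ij vE; apply: big1 => r _.
by case/alt_multilinearP: (alt r) => _ /(_ i j) ->; rewrite ?mulr0.
Qed.

Lemma row_row_perm m k (s : 'S_k) i (v : 'M[R[i]]_(k, m)) :
  row i (row_perm s v) = row (s i) v.
Proof. by apply/rowP => l; rewrite !mxE. Qed.

Lemma row_perm_tperm m k (i j : 'I_k) (v : 'M[R[i]]_(k, m)) :
  i != j ->
  row_perm (tperm i j) v = set_row i (row j v) (set_row j (row i v) v).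
Proof.
move=> ij; apply/row_matrixP => r; rewrite row_row_perm.
have [->|ri] := eqVneq r i; first by rewrite tpermL row_set_row.
rewrite row_set_row_neq //.
have [->|rj] := eqVneq r j; first by rewrite tpermR row_set_row.
by rewrite row_set_row_neq // tpermD // eq_sym.
Qed.

(** Polarization of the vanishing of [a] when the rows [i] and [j] are both
    replaced by their sum. *)
Lemma alt_tperm m k (a : covector R m k) (i j : 'I_k) (v : 'M[R[i]]_(k, m)) :
  alt_multilinear a -> i != j -> a (row_perm (tperm i j) v) = - a v.
Proof.
move=> /alt_multilinearP[lin alt] ij; rewrite row_perm_tperm //.
pose s := row i v + row j v.
have linD r (u w : 'rV[R[i]]_m) z :
    a (set_row r (u + w) z) = a (set_row r u z) + a (set_row r w z).
  by have := lin r u w z 1 1; rewrite !scale1r !mul1r.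
have : a (set_row i s (set_row j s v)) = 0.
  apply: (alt i j) => //.
  by rewrite row_set_row row_set_row_neq 1?eq_sym // row_set_row.
rewrite /s linD !(set_rowC _ _ _ ij) !linD -!(set_rowC _ _ _ ij).
have -> : a (set_row i (row i v) (set_row j (row i v) v)) = 0.
  apply: (alt i j) => //.
  by rewrite row_set_row row_set_row_neq 1?eq_sym // row_set_row.
have -> : a (set_row i (row j v) (set_row j (row j v) v)) = 0.
  apply: (alt i j) => //.
  by rewrite row_set_row row_set_row_neq 1?eq_sym // row_set_row.
have -> : set_row i (row i v) (set_row j (row j v) v) = v.
  by rewrite set_row_id set_row_id.
by rewrite addr0 add0r => /eqP; rewrite addrC addr_eq0 => /eqP ->.
Qed.

Lemma alt_row_perm m k (a : covector R m k) (s : 'S_k) (v : 'M[R[i]]_(k, m)) :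
  alt_multilinear a -> a (row_perm s v) = (-1) ^+ s * a v.
Proof.
move=> alt; have [ts -> dts] := prod_tpermP s.
elim: ts dts v => [_|[i j] ts IH /= /andP[ij dts]] v.
  by rewrite big_nil odd_perm1 expr0 mul1r row_perm1.
rewrite big_cons row_permM /= alt_tperm // IH // odd_mul_tperm ij.
by rewrite signr_addb expr1 mulN1r mulNr.
Qed.

End Multilinear.
(** * Wedge products with a 1-form, and contraction *)

Section Contraction.
Context {R : realType}.
Implicit Types m k : nat.

Lemma row'_row_perm m k (i j : 'I_k.+1) (s : 'S_k) (v : 'M[R[i]]_(k.+1, m)) :
  row' i (row_perm (lift_perm i j s) v) = row_perm s (row' j v).
Proof. by apply/matrixP => r l; rewrite !mxE lift_perm_lift. Qed.

(** The permutations are grouped by the row that they bring to the front. As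
    [b] alternates, the [k`!] permutations of a group contribute equally, which
    cancels the normalization. *)
Lemma wedge_prod1E m k (a : covector R m 1) (b : covector R m k)
    (v : 'M[R[i]]_(k.+1, m)) :
  alt_multilinear b ->
  wedge_prod a b v =
  \sum_(i < k.+1) (-1) ^+ i * (a (row i v) * b (row' i v)).
Proof.
move=> alt; rewrite /wedge_prod (_ : (1`! * k`!)%N = k`!) ?mul1n //.
pose F (s : 'S_(k.+1)) := (-1) ^+ odd_perm s *
  (a (row (s ord0) v) * b (row' ord0 (row_perm s v))).
have -> : \sum_(s : 'S_(1 + k)) (-1) ^+ odd_perm s *
     (a (usubmx (row_perm s v)) * b (dsubmx (row_perm s v))) =
   \sum_(s : 'S_(k.+1)) F s.
  apply: eq_bigr => s _; congr (_ * (a _ * b _)).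
    apply/rowP => l; rewrite !mxE; congr (v (s _) l); exact: val_inj.
  by apply/matrixP => r l; rewrite !mxE; congr (v (s _) l); exact: val_inj.
rewrite (partition_big (fun s : 'S_k.+1 => s ord0) predT) //= mulr_sumr.
apply: eq_bigr => i _.
rewrite (reindex (lift_perm ord0 i)); last first.
  (* [ulsf] deletes an index and its image from a permutation *)
  pose ulsf i (s : 'S_k.+1) r := odflt r (unlift (s i) (s (lift i r))).
  have ulsfK i' (s : 'S_k.+1) r : lift (s i') (ulsf i' s r) = s (lift i' r).
    rewrite /ulsf; have := neq_lift i' r.
    by rewrite -(can_eq (permK s)) => /unlift_some[] ? ? ->.
  have inj_ulsf : injective (ulsf ord0 _).
    move=> s; apply: can_inj (ulsf (s ord0) s^-1%g) _ => r.
    by rewrite {1}/ulsf ulsfK !permK liftK.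
  exists (fun s => perm (inj_ulsf s)) => [s _ | s].
    by apply/permP => r; rewrite permE /ulsf lift_perm_lift lift_perm_id liftK.
  move/(s _ =P _) => si0; apply/permP => r.
  case: (unliftP ord0 r) => [r'|] ->; rewrite ?lift_perm_id //.
  by rewrite lift_perm_lift -si0 permE ulsfK.
rewrite (eq_bigl predT) => [|s]; last by rewrite lift_perm_id eqxx.
have FE s : F (lift_perm ord0 i s) = (-1) ^+ i * (a (row i v) * b (row' i v)).
  rewrite /F lift_perm_id row'_row_perm alt_row_perm //.
  rewrite odd_lift_perm /= signr_addb signr_odd.
  by rewrite [a _ * _]mulrCA -!mulrA [X in _ * X]mulrA -expr2 sqrr_sign mul1r.
rewrite (eq_bigr _ (fun s _ => FE s)) sumr_const card_Sn.
by rewrite -[X in _ * X]mulr_natl mulKf // pnatr_eq0 -lt0n fact_gt0.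
Qed.

Lemma col_mx_ord0 m k (Z : 'rV[R[i]]_m) (v : 'M[R[i]]_(k, m)) l :
  (col_mx Z v : 'M[R[i]]_(k.+1, m)) ord0 l = Z 0 l.
Proof.
have -> : ord0 = lshift k (ord0 : 'I_1) by apply: val_inj.
exact: (@col_mxEu _ 1 k m Z v).
Qed.

Lemma col_mx_lift m k (Z : 'rV[R[i]]_m) (v : 'M[R[i]]_(k, m)) j l :
  (col_mx Z v : 'M[R[i]]_(k.+1, m)) (lift ord0 j) l = v j l.
Proof.
have -> : lift ord0 j = rshift 1 j by apply: val_inj.
exact: (@col_mxEd _ 1 k m Z v).
Qed.

Lemma alt_interior_prod m k (Z : 'rV[R[i]]_m) (a : covector R m k.+1) :
  alt_multilinear a -> alt_multilinear (interior_prod Z a).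
Proof.
move=> /alt_multilinearP[lin alt].
apply/alt_multilinearP; split.
  move=> i u w v x y; rewrite /interior_prod.
  have E z : col_mx Z (set_row i z v) =
             set_row (lift ord0 i) z (col_mx Z v : 'M[R[i]]_(k.+1, m)).
    apply/matrixP => r l; rewrite [RHS]mxE /=.
    case: (unliftP ord0 r) => [r' ->|->]; last by rewrite !col_mx_ord0.
    by rewrite !col_mx_lift mxE (inj_eq lift_inj).
  by rewrite !E lin.
move=> i j v ij vE; apply: (alt (lift ord0 i) (lift ord0 j)).
  by rewrite (inj_eq lift_inj).
apply/rowP => l; rewrite [LHS]mxE [RHS]mxE !col_mx_lift.
by move/rowP/(_ l): vE; rewrite !mxE.
Qed.

(** The cycle that moves the front row to the place [i] has sign [(-1) ^+ i]. *)
Lemma interior_prod_row' m k (Z : 'rV[R[i]]_m) (a : covector R m k.+1)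
    (i : 'I_k.+1) (v : 'M[R[i]]_(k.+1, m)) :
  alt_multilinear a ->
  interior_prod Z a (row' i v) = (-1) ^+ i * a (set_row i Z v).
Proof.
move=> alt; rewrite /interior_prod.
have -> : set_row i Z v =
    row_perm (lift_perm i ord0 1) (col_mx Z (row' i v) : 'M[R[i]]_(k.+1, m)).
  apply/matrixP => r l; rewrite [LHS]mxE [RHS]mxE.
  case: (unliftP i r) => [r' ->|->].
    rewrite lift_perm_lift perm1 eq_sym (negbTE (neq_lift _ _)).
    by rewrite col_mx_lift mxE.
  by rewrite lift_perm_id eqxx col_mx_ord0.
rewrite alt_row_perm // odd_lift_perm odd_perm1 /= !addbF signr_odd.
by rewrite mulrA -expr2 sqrr_sign mul1r.
Qed.

(** The contraction is a derivation: the sign of [interior_prod_row'] cancels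
    the one in the expansion of the wedge product. *)
Lemma contract_formE n k (f : 'I_n -> covector R (n + n) 1)
    (a : covector R (n + n) k) (v : 'M[R[i]]_(k, n + n)) :
  alt_multilinear a ->
  contract_form f a v =
  \sum_i a (set_row i (\sum_l f l (row i v) *: d_dz l) v).
Proof.
case: k a v => [|k] a v alt; first by rewrite big_ord0.
have [lin _] := (alt_multilinearP a).1 alt.
under eq_bigr do rewrite multilinear_sum //.
rewrite exchange_big; apply: eq_bigr => l _.
rewrite wedge_prod1E; last exact: alt_interior_prod.
apply: eq_bigr => i _; rewrite interior_prod_row' //.
by rewrite mulrCA [X in _ * X]mulrA -expr2 sqrr_sign mul1r.
Qed.

Lemma multilinear_contract_form n k (f : 'I_n -> covector R (n + n) 1)
    (a : covector R (n + n) k) :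
  (forall l, multilinear (f l)) -> alt_multilinear a ->
  multilinear (contract_form f a).
Proof.
move=> linf alt i u w v x y.
rewrite !contract_formE // !mulr_sumr -big_split /=.
have [lin _] := (alt_multilinearP a).1 alt.
have fE l : f l (x *: u + y *: w) = x * f l u + y * f l w.
  have := linf l ord0 u w 0 x y.
  have E z : set_row ord0 z (0 : 'rV[R[i]]_(n + n)) = z.
    by apply/rowP => r; rewrite !mxE eqxx.
  by rewrite !E.
apply: eq_bigr => j _; have [->|ji] := eqVneq j i.
  rewrite !row_set_row !set_row_set_row -lin; congr (a (set_row _ _ _)).
  rewrite !scaler_sumr -big_split; apply: eq_bigr => l _.
  by rewrite fE scalerDl !scalerA.
by rewrite !row_set_row_neq // !(set_rowC _ _ _ ji) lin.
Qed.

End Contraction.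
(** * Vectors of type (1,0) and (0,1) on C^n *)

Section Types.
Context {R : realType} {n : nat}.
Implicit Types (j : 'I_n) (u w : 'rV[R[i]]_(n + n)).

Local Notation cj := (map_mx (@conjc R)).

Definition d_dzbar j : 'rV[R[i]]_(n + n) :=
  2%:R^-1 *: ('e_(lshift n j) + 'i *: 'e_(rshift n j)).

Lemma i2E : 'i * 'i = -1 :> R[i].
Proof. by rewrite -expr2 sqr_i. Qed.

Lemma dz_lincomb (I : finType) j (x : I -> R[i]) (u : I -> 'rV_(n + n)) :
  dz j (\sum_a x a *: u a) = \sum_a x a * dz j (u a).
Proof.
rewrite /dz !summxE mulr_sumr -big_split /=.
by apply: eq_bigr => a _; rewrite !mxE; ring.
Qed.

Lemma dzbar_lincomb (I : finType) j (x : I -> R[i]) (u : I -> 'rV_(n + n)) :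
  dzbar j (\sum_a x a *: u a) = \sum_a x a * dzbar j (u a).
Proof.
rewrite /dzbar !summxE mulr_sumr -sumrB.
by apply: eq_bigr => a _; rewrite !mxE; ring.
Qed.

Lemma dzD j u w : dz j (u + w) = dz j u + dz j w.
Proof. by rewrite /dz !mxE; ring. Qed.

Lemma dzbarD j u w : dzbar j (u + w) = dzbar j u + dzbar j w.
Proof. by rewrite /dzbar !mxE; ring. Qed.

Lemma dzbar_conj j u : dzbar j (cj u) = (dz j u)^*.
Proof.
rewrite /dzbar /dz !mxE raddfD /= rmorphM /=; congr (_ + _).
by rewrite -mulNr; congr (_ * _); apply/eqP; rewrite eq_complex /= oppr0 !eqxx.
Qed.

Lemma cjK : involutive (cj : 'rV[R[i]]_(n + n) -> 'rV_(n + n)).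
Proof. by move=> u; apply/rowP => l; rewrite !mxE conjcK. Qed.

Lemma dz_conj j u : dz j (cj u) = (dzbar j u)^*.
Proof. by rewrite -{2}[u]cjK dzbar_conj conjcK. Qed.

Lemma row_dz_ext u w :
  (forall j, dz j u = dz j w) -> (forall j, dzbar j u = dzbar j w) -> u = w.
Proof.
move=> d1 d2; apply/rowP => l.
have two0 : (2%:R : R[i]) != 0 by rewrite pnatr_eq0.
have i0 : ('i : R[i]) != 0 by rewrite eq_complex /= negb_and oner_eq0 orbT.
rewrite -(fintype.splitK l); case: (fintype.split l) => j /=.
  have E (v : 'rV[R[i]]_(n + n)) :
      v 0 (lshift n j) = 2%:R^-1 * (dz j v + dzbar j v).
    by rewrite /dz /dzbar; field.
  by rewrite !E d1 d2.
have E (v : 'rV[R[i]]_(n + n)) :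
    v 0 (rshift n j) = (2%:R * 'i)^-1 * (dz j v - dzbar j v).
  by rewrite /dz /dzbar; field.
by rewrite !E d1 d2.
Qed.

Lemma basis_coord (j k : 'I_n) :
  [/\ ('e_(lshift n j) : 'rV[R[i]]_(n + n)) 0 (lshift n k) = (j == k)%:R,
      ('e_(lshift n j) : 'rV[R[i]]_(n + n)) 0 (rshift n k) = 0,
      ('e_(rshift n j) : 'rV[R[i]]_(n + n)) 0 (lshift n k) = 0 &
      ('e_(rshift n j) : 'rV[R[i]]_(n + n)) 0 (rshift n k) = (j == k)%:R].
Proof.
rewrite !mxE !eqxx /= (inj_eq (@lshift_inj _ _)) (inj_eq (@rshift_inj _ _)).
by rewrite eq_lrshift eq_rlshift [k == j]eq_sym.
Qed.

Lemma dz_dual (j k : 'I_n) :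
  [/\ dz k (@d_dz R n j) = (j == k)%:R, dzbar k (@d_dz R n j) = 0,
      dz k (d_dzbar j) = 0 & dzbar k (d_dzbar j) = (j == k)%:R].
Proof.
have two0 : (2%:R : R[i]) != 0 by rewrite pnatr_eq0.
have [e1 e2 e3 e4] := basis_coord j k.
pose el : 'rV[R[i]]_(n + n) := 'e_(lshift n j).
pose er : 'rV[R[i]]_(n + n) := 'e_(rshift n j).
have E (x y : R[i]) :
    [/\ dz k (2%:R^-1 *: (x *: el + y *: er))
          = 2%:R^-1 * (x + 'i * y) * (j == k)%:R &
        dzbar k (2%:R^-1 *: (x *: el + y *: er))
          = 2%:R^-1 * (x - 'i * y) * (j == k)%:R].
  have c (l : 'I_(n + n)) : (2%:R^-1 *: (x *: el + y *: er)) 0 l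
       = 2%:R^-1 * (x * el 0 l + y * er 0 l).
    rewrite [LHS]mxE; congr (_ * _); rewrite [LHS]mxE.
    by congr (_ + _); rewrite [LHS]mxE.
  by rewrite /dz /dzbar !c e1 e2 e3 e4; split; ring.
have d1 : d_dz j = 2%:R^-1 *: (1 *: el + (- 'i) *: er).
  by congr (_ *: (_ + _)); rewrite ?scale1r ?scaleNr.
have d2 : d_dzbar j = 2%:R^-1 *: (1 *: el + 'i *: er).
  by congr (_ *: (_ + _)); rewrite scale1r.
have [A B] := E 1 (- 'i); have [C D] := E 1 'i.
have iN : 'i * - 'i = 1 :> R[i] by rewrite mulrN i2E opprK.
split; rewrite ?d1 ?d2.
- by rewrite A iN; field.
- by rewrite B iN; field.
- by rewrite C i2E; field.
- by rewrite D i2E; field.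
Qed.

Definition proj10 u := \sum_j dz j u *: @d_dz R n j.
Definition proj01 u := \sum_j dzbar j u *: d_dzbar j.

Lemma sum_delta (f : 'I_n -> R[i]) k : \sum_j f j * (j == k)%:R = f k.
Proof.
rewrite (bigD1 k) //= eqxx mulr1 big1 ?addr0 // => j /negbTE ->.
by rewrite mulr0.
Qed.

Lemma dz_proj k u :
  [/\ dz k (proj10 u) = dz k u, dzbar k (proj10 u) = 0,
      dz k (proj01 u) = 0 & dzbar k (proj01 u) = dzbar k u].
Proof.
split.
- rewrite dz_lincomb -[RHS](sum_delta (fun j => dz j u)).
  by apply: eq_bigr => j _; have [-> _ _ _] := dz_dual j k.
- rewrite dzbar_lincomb.
  by apply: big1 => j _; have [_ -> _ _] := dz_dual j k; rewrite mulr0.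
- rewrite dz_lincomb.
  by apply: big1 => j _; have [_ _ -> _] := dz_dual j k; rewrite mulr0.
- rewrite dzbar_lincomb -[RHS](sum_delta (fun j => dzbar j u)).
  by apply: eq_bigr => j _; have [_ _ _ ->] := dz_dual j k.
Qed.

Lemma proj_decomp u : u = proj10 u + proj01 u.
Proof.
apply: row_dz_ext => k; have [a b c d] := dz_proj k u.
  exact: esym (etrans (dzD k _ _) (etrans (congr2 +%R a c) (addr0 _))).
exact: esym (etrans (dzbarD k _ _) (etrans (congr2 +%R b d) (add0r _))).
Qed.

Lemma std10P u : std10 u <-> forall j, dzbar j u = 0.
Proof.
split=> [[x ->] j|u01].
  rewrite dzbar_lincomb; apply: big1 => k _.
  by have [_ -> _ _] := dz_dual k j; rewrite mulr0.
exists (fun j => dz j u); apply: row_dz_ext => k.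
  by have [E _ _ _] := dz_proj k u; exact: esym E.
by have [_ E _ _] := dz_proj k u; exact: etrans (u01 k) (esym E).
Qed.

Lemma std01P u : std10 (cj u) <-> forall j, dz j u = 0.
Proof.
rewrite std10P; split=> h j; last by rewrite dzbar_conj h conjc0.
by apply/eqP; rewrite -conjc_eq0 -dzbar_conj h.
Qed.

Lemma dzZ j x u : dz j (x *: u) = x * dz j u.
Proof. by rewrite /dz !mxE; ring. Qed.

Lemma dzbarZ j x u : dzbar j (x *: u) = x * dzbar j u.
Proof. by rewrite /dzbar !mxE; ring. Qed.

(** Multiplication by [z] on (1,0)-vectors and by 1 on (0,1)-vectors: the
    pullback of a form of type (p,q) is its multiple by the p-th power of [z],
    so that the components of a form are combinations of such pullbacks. *)
Definition scale10 (z : R[i]) : 'M[R[i]]_(n + n) :=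
  block_mx ((z + 1) / 2%:R)%:M (- 'i * (z - 1) / 2%:R)%:M
           ('i * (z - 1) / 2%:R)%:M ((z + 1) / 2%:R)%:M.

Lemma scale10E z u j :
  dz j (u *m scale10 z) = z * dz j u /\ dzbar j (u *m scale10 z) = dzbar j u.
Proof.
have two0 : (2%:R : R[i]) != 0 by rewrite pnatr_eq0.
rewrite /scale10 -{1 3}[u]hsubmxK mul_row_block !mul_mx_scalar /dz /dzbar.
rewrite !row_mxEl !row_mxEr.
rewrite ![(_ + _ : 'rV_n) _ _]mxE ![(_ *: _ : 'rV_n) _ _]mxE.
rewrite ![(lsubmx _) _ _]mxE ![(rsubmx _) _ _]mxE.
set x := u 0 _; set y := u 0 (rshift n j).
set t := (z - 1) / 2%:R; set s := (z + 1) / 2%:R.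
have -> : - 'i * (z - 1) / 2%:R = - ('i * t) by rewrite /t; ring.
have -> : 'i * (z - 1) / 2%:R = 'i * t by rewrite /t; ring.
have zE : z = s + t by rewrite /s /t; field.
have oE : 1 = s - t :> R[i] by rewrite /s /t; field.
split.
  (* the squares of ['i] are isolated, as [ring] takes ['i] for a variable *)
  rewrite zE.
  rewrite -[LHS](_ : (s - 'i * 'i * t) * x + 'i * (s * y + t * y) = _);
    last by ring.
  by rewrite i2E; ring.
rewrite -[LHS](_ : (s + 'i * 'i * t) * x - 'i * ((s - t) * y) = _);
  last by ring.
by rewrite i2E -oE mulN1r mul1r -oE mul1r.
Qed.

(** The weights are a column of the inverse of the Vandermonde matrix of the
    nodes 0, .., k. *)
Lemma interpolation_weights (k p : nat) : (p <= k)%N ->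
  exists c : 'I_k.+1 -> R[i], forall s, (s <= k)%N ->
    \sum_j c j * (j%:R) ^+ s = (s == p)%:R.
Proof.
move=> pk; pose x : 'rV[R[i]]_k.+1 := \row_j j%:R.
have V1 : Vandermonde k.+1 x \in unitmx.
  rewrite unitmxE unitfE det_Vandermonde; apply/prodf_neq0 => i _.
  apply/prodf_neq0 => j ij; rewrite !mxE subr_eq0 eqr_nat.
  by rewrite neq_ltn ij orbT.
pose W := invmx (Vandermonde k.+1 x).
exists (fun j : 'I_k.+1 => W j (inord p)) => s sk.
have := congr1 (fun A : 'M[R[i]]_k.+1 => A (inord s) (inord p)) (mulmxV V1).
have -> : (s == p) = (inord s == inord p :> 'I_k.+1).
  by rewrite -(inj_eq val_inj) /= !inordK.
rewrite [LHS]mxE [RHS]mxE => <-.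
by apply: eq_bigr => j _; rewrite !mxE inordK // mulrC.
Qed.

Definition pure k (S : {set 'I_k}) (v : 'M[R[i]]_(k, n + n)) : Prop :=
  (forall i, i \in S -> std10 (row i v)) /\
  (forall i, i \notin S -> std10 (cj (row i v))).

Lemma pure_rows k (v : 'M[R[i]]_(k, n + n)) :
  (forall i, std10 (row i v) \/ std10 (cj (row i v))) -> exists S, pure S v.
Proof.
move=> h; exists [set i | `[< std10 (row i v) >]]%SET; split => i; rewrite inE.
  by move/asboolP.
by move/asboolPn => ni; case: (h i).
Qed.

Lemma multilinear_scale10 k (a : covector R (n + n) k) z (S : {set 'I_k}) v :
  multilinear a -> pure S v -> a (v *m scale10 z) = z ^+ #|S| * a v.
Proof.
move=> lin [v10 v01].
rewrite (@multilinear_scale_rows _ _ _ a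
  (fun i => if i \in S then z else 1) _ v) //.
  by rewrite -big_mkcond prodr_const.
move=> i; rewrite row_mul; apply: row_dz_ext => j;
  have [d1 d2] := scale10E z (row i v) j; rewrite ?d1 ?d2 ?dzZ ?dzbarZ.
  case: ifPn => // iS; rewrite mul1r.
  by have /std01P -> := v01 _ iS; rewrite mulr0.
case: ifPn => [iS|_]; last by rewrite mul1r.
by have /std10P -> := v10 _ iS; rewrite mulr0.
Qed.

Lemma multilinear_ext_pure k (a b : covector R (n + n) k) :
  multilinear a -> multilinear b ->
  (forall S v, pure S v -> a v = b v) -> a = b.
Proof.
move=> lina linb ab.
apply: (multilinear_ext (P := [set u | std10 u \/ std10 (cj u)])) => //.
  move=> u; exists (proj10 u), (proj01 u); split.
  - by left; apply/std10P => j; have [] := dz_proj j u.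
  - by right; apply/std01P => j; have [] := dz_proj j u.
  - exact: proj_decomp.
by move=> v /pure_rows[S]; apply: ab.
Qed.

End Types.
(** * Directional derivatives and smooth functions *)

Section Young.
Context {R : realType}.

(** The two difference quotients coincide. *)
Lemma derive_comp_affine (V1 V2 W : normedModType R) (f : V2 -> W)
    (g : V1 -> V2) (x v : V1) (w : V2) :
  (forall h : R, g (h *: v + x) = h *: w + g x) ->
  'D_v (f \o g) x = 'D_w f (g x) /\
  (derivable (f \o g) x v <-> derivable f (g x) w).
Proof.
move=> gE; rewrite /derive /derivable.
suff -> : (fun h : R => h^-1 *: ((f \o g \o shift x) (h *: v) - (f \o g) x)) =
          (fun h : R => h^-1 *: ((f \o shift (g x)) (h *: w) - f (g x))) by [].
by apply/funext => h; rewrite /= gE.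
Qed.

Variable V : normedModType R.
Implicit Types (f : V -> R) (x a b : V).

Lemma diff_increment_bound (g : V -> R) x (e : R) :
  differentiable g x -> 0 < e ->
  exists2 d : R, 0 < d &
    forall u, `|u| < d -> `|g (u + x) - g x - 'd g x u| <= e * `|u|.
Proof.
move=> dg e0; have /eqaddoP/(_ e e0) := diff_locally dg.
rewrite -nbhs_nearE => /nbhs_ballP[d /= d0 dH]; exists d => // u ud.
have := dH u; rewrite -ball_normE /= sub0r normrN => /(_ ud).
by rewrite /= opprD addrA.
Qed.

(** The mean value theorem applied to [s |-> f (x + s a + h b) - f (x + s a)]
    turns the second difference into an increment of ['D_a f], which
    differentiability at the single point [x] controls. *)
Lemma second_difference f x a b (e : R) :
  (\near x, derivable f x a) -> differentiable ('D_a f) x -> 0 < e ->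
  exists2 d : R, 0 < d & forall h : R, 0 < h < d ->
    `|f (h *: a + (h *: b + x)) - f (h *: b + x) - f (h *: a + x) + f x
      - h * (h * 'D_b ('D_a f) x)| <= h * (h * e).
Proof.
(* The error is at most e times [h (2 |a| + 2 |b|)]; the 1 makes [N] positive. *)
move=> fa dfa e0; set N := 2%:R * (`|a| + `|b|) + 1.
have N0 : 0 < N by rewrite /N ltr_wpDl // mulr_ge0 ?addr_ge0.
have [d1 d10 H1] := diff_increment_bound dfa (divr_gt0 e0 N0).
have /nbhs_ballP[d2 /= d20 H2] : nbhs x [set y | derivable f y a] by [].
exists (Num.min d1 d2 / N); first by rewrite divr_gt0 // lt_min d10 d20.
move=> h /andP[h0]; rewrite ltr_pdivlMr // lt_min => /andP[hd1 hd2].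
have bnd (s : R) (r : R) : 0 <= s <= h -> 0 <= r <= h ->
    `|s *: a + r *: b| <= h * (`|a| + `|b|).
  move=> /andP[s0 sh] /andP[r0 rh].
  rewrite (le_trans (ler_normD _ _)) // mulrDr !normrZ !ger0_norm //.
  by rewrite lerD // ler_wpM2r.
have abN : `|a| + `|b| <= N.
  by rewrite /N; have := normr_ge0 a; have := normr_ge0 b; lra.
have small s r : 0 <= s <= h -> 0 <= r <= h ->
    `|s *: a + r *: b| < d1 /\ `|s *: a + r *: b| < d2.
  move=> sh rh; have := bnd _ _ sh rh.
  have : h * (`|a| + `|b|) <= h * N by rewrite ler_pM2l.
  by split; lra.
have hh : 0 <= h <= h by rewrite lexx ltW.
have oh : 0 <= (0 : R) <= h by rewrite lexx ltW.
pose phi (s : R) := f (s *: a + (h *: b + x)) - f (s *: a + x).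
have dphi (s : R) : 0 <= s <= h ->
  is_derive s 1 phi ('D_a f (s *: a + (h *: b + x)) - 'D_a f (s *: a + x)).
  move=> sh.
  have D (y : V) : ball x d2 (s *: a + y) ->
      is_derive s 1 (fun t : R => f (t *: a + y)) ('D_a f (s *: a + y)).
    move=> ys; have [E1 E2] := derive_comp_affine f
      (g := fun t : R => t *: a + y) (x := s) (v := 1) (w := a)
      (fun r => ltac:(by rewrite /= scalerDl addrA -[r *: 1]/(r * 1) mulr1)).
    by apply: DeriveDef => //; apply/E2; exact: H2.
  apply: is_deriveB; apply: D; rewrite -ball_normE /= distrC.
    by rewrite addrA addrK; have [] := small s h sh hh.
  by rewrite addrK; have [] := small s 0 sh oh; rewrite scale0r addr0.
have [|s|c /itvP ch E] := @MVT R phi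
  (fun s => 'D_a f (s *: a + (h *: b + x)) - 'D_a f (s *: a + x)) 0 h h0.
- by move=> s /itvP sh; apply: dphi; rewrite !ltW ?sh.
- apply: derivable_within_continuous => r /itvP rh.
  by have [] := dphi r ltac:(by rewrite !rh).
have -> : f (h *: a + (h *: b + x)) - f (h *: b + x) - f (h *: a + x) + f x =
          phi h - phi 0.
  by rewrite /phi !scale0r !add0r; ring.
rewrite E subr0 mulrC -mulrBr normrM (gtr0_norm h0) ler_pM2l //.
have c0h : 0 <= c <= h by rewrite !ltW ?ch.
have -> : 'D_b ('D_a f) x = 'd ('D_a f) x b by rewrite deriveE.
have -> : h * 'd ('D_a f) x b =
    'd ('D_a f) x (c *: a + h *: b) - 'd ('D_a f) x (c *: a).
  by rewrite linearD addrAC subrr add0r linearZ.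
have [s1 _] := small c h c0h hh; have [s2 _] := small c 0 c0h oh.
rewrite scale0r addr0 in s2.
have := H1 _ s1; have := H1 _ s2; rewrite -!addrA.
set G := 'D_a f x; set G1 := 'D_a f _; set G2 := 'D_a f _.
set L1 := 'd _ _ _; set L2 := 'd _ _ _ => B2 B1.
have b1 := bnd c h c0h hh; have b2 := bnd c 0 c0h oh.
rewrite scale0r addr0 in b2.
have -> : G2 + (- G1 + - (L2 + - L1)) =
    (G2 + (- G + - L2)) - (G1 + (- G + - L1)).
  by ring.
apply: (le_trans (ler_normB _ _)); apply: (le_trans (lerD B1 B2)).
have hN : `|c *: a + h *: b| + `|c *: a| <= h * N by rewrite /N; lra.
have eN0 : 0 <= e / N by rewrite ltW // divr_gt0.
rewrite -mulrDr; apply: (le_trans (ler_wpM2l eN0 hN)).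
rewrite [leLHS](_ : _ = h * e) //; field; exact: lt0r_neq0.
Qed.

(** Young's theorem: both mixed derivatives are the limit of the same second
    difference, which is symmetric in [a] and [b]. *)
Lemma mixed_derivatives_eq f x a b :
  (\near x, derivable f x a) -> (\near x, derivable f x b) ->
  differentiable ('D_a f) x -> differentiable ('D_b f) x ->
  'D_a ('D_b f) x = 'D_b ('D_a f) x.
Proof.
move=> fa fb dfa dfb; apply/eqP; rewrite -subr_eq0 -normr_le0.
apply/ler_addgt0Pr => e e0; rewrite add0r.
have e2 : 0 < e / 2%:R by rewrite divr_gt0.
have [d1 d10 H1] := second_difference b fa dfa e2.
have [d2 d20 H2] := second_difference a fb dfb e2.
pose h := Num.min d1 d2 / 2%:R.
have m0 : 0 < Num.min d1 d2 by rewrite lt_min d10 d20.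
have h0 : 0 < h by rewrite divr_gt0.
have : h < Num.min d1 d2 by rewrite /h; lra.
rewrite lt_min => /andP[hd1 hd2].
have := H1 h; rewrite h0 hd1 => /(_ isT) B1.
have := H2 h; rewrite h0 hd2 => /(_ isT) B2.
have hh : 0 < h * h by rewrite mulr_gt0.
rewrite -(ler_pM2l hh) -[X in X * `|_|]gtr0_norm // -normrM.
move: B1 B2; rewrite (addrCA (h *: a)).
set S := f (h *: b + _); set u := f (h *: b + x); set w := f (h *: a + x).
set P := 'D_b _ _; set Q := 'D_a _ _ => B1 B2.
have -> : h * h * (Q - P) =
    (S - u - w + f x - h * (h * P)) - (S - w - u + f x - h * (h * Q)) by ring.
apply: (le_trans (ler_normB _ _)); apply: (le_trans (lerD B1 B2)).
by rewrite -mulrDr -mulrDr -splitr mulrA.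
Qed.

End Young.
Section SmoothFunctions.
Context {R : realType}.

Lemma near_eq_differentiable (V W : normedModType R) (f g : V -> W) x :
  (\near x, f x = g x) -> differentiable f x -> differentiable g x.
Proof.
move=> fg df; have fgx : f x = g x := nbhs_singleton fg.
have H : g \o shift x = cst (g x) + 'd f x +o_ 0 id.
  apply/eqaddoP => e e0; have /eqaddoP/(_ e e0) := diff_locally df.
  apply: filter_app; have := fg; rewrite (near_shift 0 x) subr0.
  apply: filter_app; near=> y => /= fgy.
  by rewrite !fctE /= /cst -[in X in _ -> X]fgy fgx.
have E := diff_unique (diff_continuous df) H.
by apply/diff_locallyP; rewrite E; split => //; exact: diff_continuous.
Unshelve. all: by end_near. Qed.

Variable m : nat.
Implicit Types (U : set 'rV[R]_m) (f g : 'rV[R]_m -> R) (s : seq 'I_m).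

Lemma open_near U x (P : set 'rV[R]_m) :
  open U -> U x -> (forall y, U y -> P y) -> \near x, P x.
Proof. by move=> oU Ux UP; apply: filterS UP _; exact: open_nbhs_nbhs. Qed.

Local Notation iterD f s := (foldr (fun i g => 'D_('e_i) g) f s).

Lemma iterD_eq U f g : open U -> (forall x, U x -> f x = g x) ->
  forall s x, U x -> iterD f s x = iterD g s x.
Proof.
move=> oU fg; elim=> [|i s IH] x Ux /=; first exact: fg.
by apply: near_eq_derive; exact: open_near Ux IH.
Qed.

Lemma smooth_on_eq U f g : open U -> (forall x, U x -> f x = g x) ->
  smooth_on U f -> smooth_on U g.
Proof.
move=> oU fg sf s x Ux; apply: near_eq_differentiable (sf s x Ux).
by apply: open_near Ux _ => // y; exact: iterD_eq fg s y.
Qed.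

Lemma smooth_on_derive U f i : smooth_on U f -> smooth_on U ('D_('e_i) f).
Proof.
by move=> sf s x Ux; have := sf (rcons s i) x Ux; rewrite foldr_rcons.
Qed.

Lemma smooth_on_derivable U f i x : smooth_on U f -> U x ->
  derivable f x 'e_i.
Proof. by move=> sf Ux; exact: diff_derivable (sf [::] x Ux). Qed.

Lemma smooth_on_lincomb U (a b : R) f g : open U ->
  smooth_on U f -> smooth_on U g -> smooth_on U (fun y => a * f y + b * g y).
Proof.
move=> oU sf sg; pose h s := a \*: (iterD f s) + b \*: (iterD g s).
have hE s : forall x, U x -> iterD (fun y => a * f y + b * g y) s x = h s x.
  elim: s => [|i s IH] x Ux //=.
  rewrite (@near_eq_derive _ _ _ _ (h s)); last exact: open_near Ux IH.
  have df := diff_derivable (v := 'e_i) (sf s x Ux).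
  have dg := diff_derivable (v := 'e_i) (sg s x Ux).
  have Df := is_deriveZ a (derivableP df).
  have Dg := is_deriveZ b (derivableP dg).
  by have [_ ->] := is_deriveD Df Dg.
move=> s x Ux; apply: (@near_eq_differentiable _ _ (h s)).
  by apply: open_near Ux _ => // y /hE ->.
by apply: differentiableD; apply: differentiableZ; [exact: sf|exact: sg].
Qed.

Lemma smooth_on_cst U (c : R) : smooth_on U (fun=> c).
Proof.
move=> s x _.
suff -> : iterD (fun=> c) s = cst (if s is [::] then c else 0).
  exact: differentiable_cst.
elim: s => [//|i s IH] /=; apply/funext => y.
by rewrite IH derive_cst.
Qed.

End SmoothFunctions.

(** * Complex-valued functions *)

Section ComplexDerivatives.
Context {R : realType}.

(** Real and imaginary parts are differentiated separately, as in [Cderiv] and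
    [Cpartial]. *)
Definition is_Cderive (V : normedModType R) (x v : V) (f : V -> R[i])
    (l : R[i]) : Prop :=
  is_derive x v (fun y => complex.Re (f y) : R) (complex.Re l) /\
  is_derive x v (fun y => complex.Im (f y) : R) (complex.Im l).

Section Rules.
Variables (V : normedModType R) (x v : V).
Implicit Types (f g : V -> R[i]) (c l : R[i]).

Lemma ReD (a b : R[i]) : complex.Re (a + b) = complex.Re a + complex.Re b.
Proof. by case: a; case: b. Qed.

Lemma ImD (a b : R[i]) : complex.Im (a + b) = complex.Im a + complex.Im b.
Proof. by case: a; case: b. Qed.

Lemma ReM (a b : R[i]) :
  complex.Re (a * b) =
  complex.Re a * complex.Re b - complex.Im a * complex.Im b.
Proof. by case: a; case: b. Qed.

Lemma ImM (a b : R[i]) :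
  complex.Im (a * b) =
  complex.Re a * complex.Im b + complex.Im a * complex.Re b.
Proof. by case: a => a1 a2; case: b. Qed.

Lemma is_Cderive_cst c : is_Cderive x v (fun=> c) 0.
Proof. by split; exact: is_derive_cst. Qed.

Lemma is_derive_ext (f g : V -> R) (df dg : R) :
  (forall y, f y = g y) -> df = dg ->
  is_derive x v f df -> is_derive x v g dg.
Proof. by move=> /funext -> ->. Qed.

Lemma is_CderiveD f g lf lg : is_Cderive x v f lf -> is_Cderive x v g lg ->
  is_Cderive x v (fun y => f y + g y) (lf + lg).
Proof.
move=> [f1 f2] [g1 g2]; split.
  by apply: is_derive_ext (is_deriveD f1 g1) => [y|]; rewrite ReD.
by apply: is_derive_ext (is_deriveD f2 g2) => [y|]; rewrite ImD.
Qed.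

Lemma is_CderiveM f g lf lg : is_Cderive x v f lf -> is_Cderive x v g lg ->
  is_Cderive x v (fun y => f y * g y) (f x * lg + lf * g x).
Proof.
move=> [f1 f2] [g1 g2]; split.
  apply: is_derive_ext (is_deriveB (is_deriveM f1 g1) (is_deriveM f2 g2)).
    by move=> y; rewrite ReM.
  by rewrite ReD !ReM /GRing.scale /=; ring.
apply: is_derive_ext (is_deriveD (is_deriveM f1 g2) (is_deriveM f2 g1)).
  by move=> y; rewrite ImM.
by rewrite ImD !ImM /GRing.scale /=; ring.
Qed.

Lemma is_CderiveZ c f l : is_Cderive x v f l ->
  is_Cderive x v (fun y => c * f y) (c * l).
Proof.
by move=> df; have := is_CderiveM (is_Cderive_cst c) df; rewrite mul0r addr0.
Qed.

Lemma is_Cderive_sum (I : Type) (r : seq I) (f : I -> V -> R[i])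
    (l : I -> R[i]) :
  (forall j, is_Cderive x v (f j) (l j)) ->
  is_Cderive x v (fun y => \sum_(j <- r) f j y) (\sum_(j <- r) l j).
Proof.
move=> df; elim: r => [|j r IH].
  rewrite big_nil (_ : (fun _ => _) = fun=> 0); first exact: is_Cderive_cst.
  by apply/funext => y; rewrite big_nil.
rewrite big_cons (_ : (fun _ => _) = fun y => f j y + \sum_(j <- r) f j y).
  exact: is_CderiveD.
by apply/funext => y; rewrite big_cons.
Qed.

Lemma is_Cderive_lincomb (I : finType) (c : I -> R[i]) (f : I -> V -> R[i])
    (l : I -> R[i]) :
  (forall j, is_Cderive x v (f j) (l j)) ->
  is_Cderive x v (fun y => \sum_j c j * f j y) (\sum_j c j * l j).
Proof. by move=> df; apply: is_Cderive_sum => j; exact: is_CderiveZ. Qed.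

Lemma is_Cderive_conj f l : is_Cderive x v f l ->
  is_Cderive x v (fun y => (f y)^*) l^*.
Proof.
move=> [f1 f2]; split.
  by apply: is_derive_ext f1 => [y|]; [case: (f y)|case: l f2].
apply: is_derive_ext (is_deriveN f2) => [y|]; last by case: l f1 f2.
by rewrite fctE; case: (f y).
Qed.

Lemma is_Cderive_unique f l l' :
  is_Cderive x v f l -> is_Cderive x v f l' -> l = l'.
Proof.
move=> [[_ f1] [_ f2]] [[_ g1] [_ g2]]; apply/eqP.
by rewrite eq_complex -f1 -f2 -g1 -g2 !eqxx.
Qed.

Lemma is_Cderive_near f g l :
  (\near x, f x = g x) -> is_Cderive x v f l -> is_Cderive x v g l.
Proof.
move=> fg [f1 f2]; split.
  by apply: near_eq_is_derive f1; apply: filterS fg => y ->.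
by apply: near_eq_is_derive f2; apply: filterS fg => y ->.
Qed.

End Rules.

Section Partial.
Variable m : nat.
Implicit Types (U : set 'rV[R]_m) (f g : 'rV[R]_m -> R[i]).

Lemma CpartialE f j x l : is_Cderive x 'e_j f l -> Cpartial j f x = l.
Proof. by move=> [[_ f1] [_ f2]]; rewrite /Cpartial f1 f2; case: l f1 f2. Qed.

Lemma Csmooth_is_Cderive U f j x : Csmooth_on U f -> U x ->
  is_Cderive x 'e_j f (Cpartial j f x).
Proof.
by move=> [s1 s2] Ux; split; apply: derivableP;
  [exact: smooth_on_derivable s1 Ux|exact: smooth_on_derivable s2 Ux].
Qed.

Lemma Cpartial_near f g j x :
  (\near x, f x = g x) -> Cpartial j f x = Cpartial j g x.
Proof.
by move=> fg; rewrite /Cpartial; congr (_ +i* _); apply: near_eq_derive;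
  apply: filterS fg => y ->.
Qed.

Lemma Csmooth_onD U f g : open U -> Csmooth_on U f -> Csmooth_on U g ->
  Csmooth_on U (fun x => f x + g x).
Proof.
move=> oU [f1 f2] [g1 g2]; split.
  apply: smooth_on_eq (smooth_on_lincomb 1 1 oU f1 g1) => // y _.
  by rewrite ReD !mul1r.
apply: smooth_on_eq (smooth_on_lincomb 1 1 oU f2 g2) => // y _.
by rewrite ImD !mul1r.
Qed.

Lemma Csmooth_onZ U c f : open U -> Csmooth_on U f ->
  Csmooth_on U (fun x => c * f x).
Proof.
move=> oU [f1 f2]; split.
  have := smooth_on_lincomb (complex.Re c) (- complex.Im c) oU f1 f2.
  apply: smooth_on_eq => // y _.
  by rewrite ReM mulNr.
have := smooth_on_lincomb (complex.Re c) (complex.Im c) oU f2 f1.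
apply: smooth_on_eq => // y _.
by rewrite ImM.
Qed.

Lemma Csmooth_on_lincomb (I : finType) U (c : I -> R[i])
    (f : I -> 'rV[R]_m -> R[i]) : open U ->
  (forall j, Csmooth_on U (f j)) ->
  Csmooth_on U (fun x => \sum_j c j * f j x).
Proof.
move=> oU sf; elim: (index_enum I) => [|j r IH].
  rewrite (_ : (fun _ => _) = fun=> 0); first by split; exact: smooth_on_cst.
  by apply/funext => y; rewrite big_nil.
rewrite (_ : (fun _ => _) = fun x => c j * f j x + \sum_(j <- r) c j * f j x).
  exact: Csmooth_onD (Csmooth_onZ _ _ _) IH.
by apply/funext => y; rewrite big_cons.
Qed.

End Partial.

End ComplexDerivatives.
(** * Families of functions depending smoothly on a parameter *)

Section Families.
Context {R : realType} {m : nat}.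
Variables (eps : R) (U : set 'rV[R]_m).
Hypotheses (eps0 : 0 < eps) (oU : open U).

Definition param_domain : set 'rV[R]_(1 + m) :=
  [set y | `]- eps, eps[%classic (lsubmx y 0 0) /\ U (rsubmx y)].

Definition param_point (t : R) (x : 'rV[R]_m) : 'rV[R]_(1 + m) :=
  row_mx t%:M x.

Lemma param_pointK t x :
  lsubmx (param_point t x) 0 0 = t /\ rsubmx (param_point t x) = x.
Proof. by rewrite /param_point row_mxKl row_mxKr mxE eqxx mulr1n. Qed.

Lemma param_domain_point t x :
  `]- eps, eps[%classic t -> U x -> param_domain (param_point t x).
Proof.
by move=> It Ux; have [E1 E2] := param_pointK t x; split; rewrite ?E1 ?E2.
Qed.

Lemma zero_in_param : `]- eps, eps[%classic (0 : R).
Proof. by rewrite /= in_itv /= oppr_lt0 eps0. Qed.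

Lemma open_param_domain : open param_domain.
Proof.
apply: openI.
  apply: (@open_comp _ _ (fun y : 'rV[R]_(1 + m) => lsubmx y 0 0)).
    move=> y _.
    apply: (@continuous_comp _ _ _ (fun y => lsubmx y) (fun z => z 0 0)).
      exact: continuous_lsubmx.
    exact: coord_continuous.
  exact: interval_open.
by apply: open_comp => // y _; exact: continuous_rsubmx.
Qed.

Lemma row_axpyE k (h : R) (a b : 'rV[R]_k) l :
  (h *: a + b) 0 l = h * a 0 l + b 0 l.
Proof. by rewrite !mxE. Qed.

Lemma param_point_x h t x i :
  param_point t (h *: 'e_i + x) = h *: 'e_(rshift 1 i) + param_point t x.
Proof.
apply/rowP => l; rewrite -(fintype.splitK l) row_axpyE /param_point.
case: (fintype.split l) => j /=.
  by rewrite !row_mxEl [delta_mx _ _ _ _]mxE eq_lrshift andbF mulr0 add0r.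
rewrite !row_mxEr row_axpyE; congr (_ * _ + _).
by rewrite !mxE (inj_eq (@rshift_inj _ _)).
Qed.

Lemma param_point_t (h t : R) x :
  param_point (h *: 1 + t) x = h *: 'e_(lshift m 0) + param_point t x.
Proof.
apply/rowP => l; rewrite -(fintype.splitK l) row_axpyE /param_point.
case: (fintype.split l) => j /=.
  by rewrite !row_mxEl !mxE (inj_eq (@lshift_inj _ _)) ord1 !eqxx !mulr1n.
by rewrite !row_mxEr !mxE eq_rlshift andbF mulr0 add0r.
Qed.

Section RealFamily.
Variable f : 'rV[R]_(1 + m) -> R.
Hypothesis sf : smooth_on param_domain f.

Lemma derive_param_x t x i :
  'D_('e_i) (fun y => f (param_point t y)) x =
  'D_('e_(rshift 1 i)) f (param_point t x).
Proof.
by have [-> _] := derive_comp_affine f (fun h => param_point_x h t x i).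
Qed.

Lemma derive_param_t t x :
  'D_1 (fun s => f (param_point s x)) t =
  'D_('e_(lshift m 0)) f (param_point t x).
Proof.
by have [-> _] := derive_comp_affine (V1 := R) f
  (g := fun s => param_point s x) (fun h => param_point_t h t x).
Qed.

Lemma derivable_param_t t x : `]- eps, eps[%classic t -> U x ->
  derivable (fun s : R => f (param_point s x)) t 1.
Proof.
move=> It Ux; have [_ E] := derive_comp_affine (V1 := R) f
  (g := fun s => param_point s x) (fun h => param_point_t h t x).
apply/E; exact: smooth_on_derivable sf (param_domain_point It Ux).
Qed.

End RealFamily.

Lemma smooth_on_slice (f : 'rV[R]_(1 + m) -> R) t : `]- eps, eps[%classic t ->
  smooth_on param_domain f -> smooth_on U (fun x => f (param_point t x)).
Proof.
move=> It sf s x Ux.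
have -> : foldr (fun i g => 'D_('e_i) g) (fun x => f (param_point t x)) s =
    (fun x => foldr (fun i g => 'D_('e_i) g) f (map (@rshift 1 m) s)
      (param_point t x)).
  elim: s => [//|i s IH] /=; apply/funext => y.
  by rewrite IH derive_param_x.
apply: (@differentiable_comp _ _ _ _ (param_point t)); last first.
  exact: sf _ _ (param_domain_point It Ux).
have -> : param_point t = cst (param_point t 0) + (fun x => row_mx 0 x).
  apply/funext => y; rewrite fctE /= /cst /param_point add_row_mx.
  by rewrite addr0 add0r.
apply: differentiableD; first exact: differentiable_cst.
have -> : (fun x : 'rV[R]_m => row_mx (0 : 'rV[R]_1) x) =
    \sum_(i < m) (fun x : 'rV[R]_m => x 0 i *: 'e_(rshift 1 i)).
  apply/funext => y; rewrite fct_sumE; apply/rowP => l.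
  rewrite summxE -(fintype.splitK l); case: (fintype.split l) => j /=.
    rewrite row_mxEl mxE big1 // => i _.
    by rewrite !mxE eq_lrshift andbF mulr0.
  rewrite row_mxEr (bigD1 j) //= big1 => [|i ij].
    by rewrite !mxE !eqxx mulr1 addr0.
  by rewrite !mxE (inj_eq (@rshift_inj _ _)) eq_sym (negbTE ij) andbF mulr0.
apply: (@differentiable_sum R 'rV[R]_m 'rV[R]_(1 + m) m
  (fun i y => y 0 i *: 'e_(rshift 1 i))) => i.
apply: (@differentiableZl R 'rV[R]_m 'rV[R]_(1 + m)).
exact: differentiable_coord.
Qed.

Section RealSlices.
Variable f : 'rV[R]_(1 + m) -> R.
Hypothesis sf : smooth_on param_domain f.

Lemma param_deriv_smooth :
  smooth_on U (fun x => (fun t => f (param_point t x))^`() 0).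
Proof.
have -> : (fun x => (fun t => f (param_point t x))^`() 0) =
    (fun x => 'D_('e_(lshift m 0)) f (param_point 0 x)).
  by apply/funext => x; rewrite derive1E derive_param_t.
exact: smooth_on_slice zero_in_param (smooth_on_derive _ sf).
Qed.

Lemma param_mixed x i : U x ->
  is_derive (0 : R) 1 (fun t => 'D_('e_i) (fun y => f (param_point t y)) x)
    ('D_('e_i) (fun y => (fun t => f (param_point t y))^`() 0) x).
Proof.
move=> Ux; have I0 := zero_in_param.
have D0 := param_domain_point I0 Ux.
have -> : (fun t => 'D_('e_i) (fun y => f (param_point t y)) x) =
    (fun t => 'D_('e_(rshift 1 i)) f (param_point t x)).
  by apply/funext => t; rewrite derive_param_x.
have -> : (fun y => (fun t => f (param_point t y))^`() 0) =
    (fun y => 'D_('e_(lshift m 0)) f (param_point 0 y)).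
  by apply/funext => y; rewrite derive1E derive_param_t.
apply: DeriveDef.
  exact: derivable_param_t (smooth_on_derive _ sf) _ _ I0 Ux.
apply: (etrans (derive_param_t ('D_('e_(rshift 1 i)) f) 0 x)).
rewrite (derive_param_x ('D_('e_(lshift m 0)) f)); apply: mixed_derivatives_eq.
- apply: open_near open_param_domain D0 _ => y Dy.
  exact: smooth_on_derivable sf Dy.
- apply: open_near open_param_domain D0 _ => y Dy.
  exact: smooth_on_derivable sf Dy.
- exact: smooth_on_derive sf [::] _ D0.
- exact: smooth_on_derive sf [::] _ D0.
Qed.

End RealSlices.

Section ComplexFamily.
Variable F : R -> 'rV[R]_m -> R[i].
Hypothesis sF : Csmooth_family eps U F.

Let f1 (y : 'rV[R]_(1 + m)) : R := complex.Re (F (lsubmx y 0 0) (rsubmx y)).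
Let f2 (y : 'rV[R]_(1 + m)) : R := complex.Im (F (lsubmx y 0 0) (rsubmx y)).

Let f1E t x : f1 (param_point t x) = complex.Re (F t x).
Proof. by have [E1 E2] := param_pointK t x; rewrite /f1 E1 E2. Qed.

Let f2E t x : f2 (param_point t x) = complex.Im (F t x).
Proof. by have [E1 E2] := param_pointK t x; rewrite /f2 E1 E2. Qed.

Let f1Et x : (fun t => f1 (param_point t x)) = (fun t => complex.Re (F t x)).
Proof. by apply/funext => t; rewrite f1E. Qed.

Let f2Et x : (fun t => f2 (param_point t x)) = (fun t => complex.Im (F t x)).
Proof. by apply/funext => t; rewrite f2E. Qed.

Let f1Ex t : (fun x => f1 (param_point t x)) = (fun x => complex.Re (F t x)).
Proof. by apply/funext => x; rewrite f1E. Qed.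

Let f2Ex t : (fun x => f2 (param_point t x)) = (fun x => complex.Im (F t x)).
Proof. by apply/funext => x; rewrite f2E. Qed.

Lemma family_is_Cderive (t : R) x : `]- eps, eps[%classic t -> U x ->
  @is_Cderive R R t 1 (F ^~ x) (Cderiv (F ^~ x) t).
Proof.
have [s1 s2] := sF; move=> It Ux.
split; rewrite /Cderiv /= derive1E; apply: derivableP.
  have := derivable_param_t (s1 : smooth_on param_domain f1) It Ux.
  by rewrite f1Et.
have := derivable_param_t (s2 : smooth_on param_domain f2) It Ux.
by rewrite f2Et.
Qed.

Lemma family_deriv_smooth : Csmooth_on U (fun x => Cderiv (F ^~ x) 0).
Proof.
have [s1 s2] := sF; split; rewrite /Cderiv /=.
  have := param_deriv_smooth (s1 : smooth_on param_domain f1).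
  by congr (smooth_on _ _); apply/funext => x; rewrite f1Et.
have := param_deriv_smooth (s2 : smooth_on param_domain f2).
by congr (smooth_on _ _); apply/funext => x; rewrite f2Et.
Qed.

Lemma family_mixed x j : U x ->
  @is_Cderive R R 0 1 (fun t => Cpartial j (F t) x)
    (Cpartial j (fun y => Cderiv (F ^~ y) 0) x).
Proof.
have [s1 s2] := sF; move=> Ux; rewrite /Cpartial /Cderiv; split => /=.
  have := param_mixed (s1 : smooth_on param_domain f1) j Ux.
  have -> : (fun t => 'D_('e_j) (fun y => f1 (param_point t y)) x) =
      (fun t => 'D_('e_j) (fun y => complex.Re (F t y) : R) x).
    by apply/funext => t; rewrite f1Ex.
  have -> : (fun y => (fun t => f1 (param_point t y))^`() 0) =
      (fun y => (fun t => complex.Re (F t y) : R)^`() 0).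
    by apply/funext => y; rewrite f1Et.
  by [].
have := param_mixed (s2 : smooth_on param_domain f2) j Ux.
have -> : (fun t => 'D_('e_j) (fun y => f2 (param_point t y)) x) =
      (fun t => 'D_('e_j) (fun y => complex.Im (F t y) : R) x).
    by apply/funext => t; rewrite f2Ex.
  have -> : (fun y => (fun t => f2 (param_point t y))^`() 0) =
      (fun y => (fun t => complex.Im (F t y) : R)^`() 0).
    by apply/funext => y; rewrite f2Et.
  by [].
Qed.

End ComplexFamily.

End Families.
(** * Variation of a form of type (p,p) along with the complex structure *)

Section Leibniz.
Context {R : realType} {m k : nat}.
Variables (a : R -> covector R m k) (a' : covector R m k).
Hypothesis da : forall v, @is_Cderive R R 0 1 (a ^~ v) (a' v).

Lemma multilinear_deriv :
  (\forall t \near (0 : R), multilinear (a t)) -> multilinear a'.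
Proof.
move=> lin i u w v x y.
have D1 := is_CderiveD (is_CderiveZ x (da (set_row i u v)))
                       (is_CderiveZ y (da (set_row i w v))).
apply: is_Cderive_unique (da _) _; apply: is_Cderive_near D1.
by apply: filterS lin => t ->.
Qed.

Lemma alt_multilinear_deriv :
  (\forall t \near (0 : R), alt_multilinear (a t)) -> alt_multilinear a'.
Proof.
move=> alt; apply/alt_multilinearP; split.
  by apply: multilinear_deriv; apply: filterS alt => t /alt_multilinearP[].
move=> i j v ij vE; apply: is_Cderive_unique (da v) _.
apply: is_Cderive_near (is_Cderive_cst _ _ 0).
by apply: filterS alt => t /alt_multilinearP[_ /(_ i j v ij vE)] ->.
Qed.

(** The product rule, proved for one more varying row at a time by expanding
    that row in the standard basis. *)
Lemma multilinear_leibniz (B : R -> 'M[R[i]]_(k, m)) (B' : 'M[R[i]]_(k, m)) :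
  (\forall t \near (0 : R), multilinear (a t)) ->
  (forall i j, @is_Cderive R R 0 1 (fun t => B t i j) (B' i j)) ->
  @is_Cderive R R 0 1 (fun t => a t (B t))
    (a' (B 0) + \sum_i a 0 (set_row i (row i B') (B 0))).
Proof.
move=> lin; have lin0 : multilinear (a 0) := nbhs_singleton lin.
have lin' := multilinear_deriv lin.
have expand (b : covector R m k) (i : 'I_k) (u v : 'M[R[i]]_(k, m)) :
    multilinear b ->
    b (set_row i (row i u) v) = \sum_j u i j * b (set_row i 'e_j v).
  by move=> linb; rewrite [row i u]row_sum_delta multilinear_sum //;
     apply: eq_bigr => j _; rewrite mxE.
suff H r : (r <= k)%N ->
    forall (B : R -> 'M[R[i]]_(k, m)) (B' : 'M[R[i]]_(k, m)),
    (forall i j, @is_Cderive R R 0 1 (fun t => B t i j) (B' i j)) ->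
    (forall i : 'I_k, (r <= i)%N -> row i B' = 0 /\
       forall t, row i (B t) = row i (B 0)) ->
    @is_Cderive R R 0 1 (fun t => a t (B t))
      (a' (B 0) + \sum_i a 0 (set_row i (row i B') (B 0))).
  by move=> dB; apply: (H k) => // i; rewrite leqNgt ltn_ord.
elim: r => [_|r IH rk] {}B {}B' dB cst.
  rewrite big1 => [|i _]; last by rewrite (cst i _).1 // multilinear0.
  rewrite addr0 (_ : (fun t => a t (B t)) = a ^~ (B 0)); first exact: da.
  apply/funext => t; congr a; apply/row_matrixP => i; exact: (cst i _).2.
pose i0 := Ordinal rk.
have D j : @is_Cderive R R 0 1 (fun t => a t (set_row i0 'e_j (B t)))
    (a' (set_row i0 'e_j (B 0)) +
     \sum_i a 0 (set_row i (row i (set_row i0 0 B')) (set_row i0 'e_j (B 0)))).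
  apply: (IH (ltnW rk) (fun t => set_row i0 'e_j (B t))).
    move=> i l; rewrite [set_row _ _ _ _ _]mxE mxE.
    rewrite (_ : (fun t => set_row i0 'e_j (B t) i l) =
      fun t => if i == i0 then ('e_j : 'rV[R[i]]_m) 0 l else B t i l);
      last first.
      by apply/funext => t; rewrite [LHS]mxE.
    by case: ifP => _; [exact: is_Cderive_cst|exact: dB].
  move=> i ri; have [->|ii0] := eqVneq i i0.
    by split=> [|t]; rewrite !row_set_row.
  have ri' : (r < i)%N.
    rewrite ltn_neqAle ri andbT; apply: contra ii0 => /eqP rE.
    by apply/eqP/val_inj.
  have [c1 c2] := cst i ri'.
  by split=> [|t]; rewrite !row_set_row_neq.
have S := is_Cderive_sum (index_enum 'I_m)
  (fun j => is_CderiveM (dB i0 j) (D j)).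
apply: (@is_Cderive_near _ _ _ _
  (fun t => \sum_j B t i0 j * a t (set_row i0 'e_j (B t)))).
  by apply: filterS lin => t lint; rewrite -expand // set_row_id.
move: S; congr (is_Cderive _ _ _ _).
rewrite big_split /= -(expand (a 0)) //.
under eq_bigr do rewrite mulrDr.
rewrite big_split /= -(expand a') // set_row_id -addrA; congr (_ + _).
rewrite [RHS](bigD1 i0) //= addrC; congr (_ + _).
under eq_bigr do rewrite mulr_sumr.
rewrite exchange_big /= (bigD1 i0) //= big1 ?add0r => [|j _]; last first.
  by rewrite row_set_row multilinear0 ?mulr0.
apply: eq_bigr => i ii0.
under eq_bigr do rewrite row_set_row_neq // set_rowC //.
rewrite -(expand (a 0)) //; congr (a _ _).
have i0i : i0 != i by rewrite eq_sym.
by rewrite -(row_set_row_neq (row i B') (B 0) i0i) set_row_id.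
Qed.

End Leibniz.
Section TypeVariation.
Context {R : realType} {n k : nat}.
Local Notation cj := (map_mx (@conjc R)).
Variables (p : nat) (H : R -> set 'rV[R[i]]_(n + n)).
Variables (w : R -> covector R (n + n) k) (w' : covector R (n + n) k).
Variables (f : R -> 'I_n -> covector R (n + n) 1)
  (f' : 'I_n -> covector R (n + n) 1).
Hypothesis dw : forall v, @is_Cderive R R 0 1 (w ^~ v) (w' v).
Hypothesis df : forall l u, @is_Cderive R R 0 1 (fun t => f t l u) (f' l u).
Hypothesis walt : \forall t \near (0 : R), alt_multilinear (w t).
Hypothesis wtype : \forall t \near (0 : R), forall (S : {set 'I_k}) v,
  (forall i, i \in S -> H t (row i v)) ->
  (forall i, i \notin S -> H t (cj (row i v))) ->
  #|S| != p -> w t v = 0.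

(** The (0,1)-vectors of the structure at time [t] form the graph of minus the
    vector form over those at time 0. *)
Definition graph01 t (u : 'rV[R[i]]_(n + n)) : 'rV[R[i]]_(n + n) :=
  u - \sum_l f t l u *: d_dz l.

Hypothesis Hgraph : \forall t \near (0 : R), forall u,
  std10 (cj u) -> H t (cj (graph01 t u)).
Hypothesis f0 : forall l u, f 0 l u = 0.
Hypothesis f10 : forall l u, std10 u -> f' l u = 0.
Hypothesis flin : forall l, multilinear (f' l).

Let walt0 : alt_multilinear (w 0) := nbhs_singleton walt.
Let wlin0 : multilinear (w 0).
Proof. by have [] := (alt_multilinearP _).1 walt0. Qed.

Let graph0 u : graph01 0 u = u.
Proof. by rewrite /graph01 big1 ?subr0 // => l _; rewrite f0 scale0r. Qed.

Let w_pure0 (S : {set 'I_k}) v : pure S v -> #|S| != p -> w 0 v = 0.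
Proof.
have G u : std10 (cj u) -> H 0 (cj u).
  by have := nbhs_singleton Hgraph u; rewrite graph0.
move=> [v10 v01] Sp; apply: (nbhs_singleton wtype S) => // i iS.
  by rewrite -[row i v]cjK; apply: G; rewrite cjK; exact: v10.
exact: G (v01 _ iS).
Qed.

Lemma std10_lincomb (x : 'I_n -> R[i]) : std10 (\sum_l x l *: @d_dz R n l).
Proof. by exists x. Qed.

(** Differentiate [w t (B t) = 0], where the rows of [B t] are the vectors of
    the structure at time [t] that correspond to the rows of [v]. A varying
    (1,0)-row contributes nothing, as its derivative has type (0,1) and leaves
    only p - 2 rows of type (1,0); the other rows contribute the terms of the
    contraction. *)
Lemma contraction_is_variation (S : {set 'I_k}) v :
  pure S v ->
  contract_form f' (w 0) v = if #|S|.+1 == p then w' v else 0.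
Proof.
move=> Sv; have [v10 v01] := Sv; rewrite contract_formE //.
pose X i := \sum_l f' l (row i v) *: @d_dz R n l.
have XS i : i \in S -> w 0 (set_row i (X i) v) = 0.
  move=> iS; rewrite /X big1 ?multilinear0 // => l _.
  by rewrite f10 ?scale0r //; exact: v10.
case: ifPn => [/eqP Sp|Sp]; last first.
  apply: big1 => i _; have [/XS //|iS] := boolP (i \in S).
  apply: (w_pure0 (S := i |: S)); last by rewrite cardsU1 iS add1n.
  split=> j; rewrite !inE; have [->|ji] /= := eqVneq j i => jS //.
  - by rewrite row_set_row; exact: std10_lincomb.
  - by rewrite row_set_row_neq //; exact: v10.
  - by rewrite row_set_row_neq //; exact: v01.
pose B t : 'M[R[i]]_(k, n + n) := \matrix_(i, j)
  (if i \in S then cj (graph01 t (cj (row i v))) 0 j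
   else graph01 t (row i v) 0 j).
pose B' : 'M[R[i]]_(k, n + n) := \matrix_(i, j)
  (if i \in S then cj (- \sum_l f' l (cj (row i v)) *: @d_dz R n l) 0 j
   else (- X i) 0 j).
have rowB t i : row i (B t) = if i \in S then cj (graph01 t (cj (row i v)))
                              else graph01 t (row i v).
  by apply/rowP => j; rewrite [LHS]mxE [LHS]mxE; case: ifP.
have rowB' i : row i B' = if i \in S
    then cj (- \sum_l f' l (cj (row i v)) *: @d_dz R n l) else - X i.
  by apply/rowP => j; rewrite [LHS]mxE [LHS]mxE; case: ifP.
have B0 : B 0 = v.
  apply/row_matrixP => i; rewrite rowB !graph0 cjK; by case: ifP.
have dgraph u j : @is_Cderive R R 0 1 (fun t => graph01 t u 0 j)
    ((- \sum_l f' l u *: @d_dz R n l) 0 j).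
  have E := is_CderiveD (is_Cderive_cst _ _ (u 0 j))
   (is_Cderive_lincomb (fun l => - (@d_dz R n l) 0 j) (fun l => df l u)).
  move: E; rewrite add0r; congr (is_Cderive _ _ _ _).
    apply/funext => t; rewrite /graph01 [RHS]mxE; congr (_ + _).
    rewrite [RHS]mxE summxE -sumrN; apply: eq_bigr => l _.
    by rewrite [in RHS]mxE mulNr mulrC.
  rewrite mxE summxE -sumrN; apply: eq_bigr => l _.
  by rewrite [in RHS]mxE mulNr mulrC.
have dB i j : @is_Cderive R R 0 1 (fun t => B t i j) (B' i j).
  have -> : (fun t => B t i j) = (fun t => if i \in S
      then (graph01 t (cj (row i v)) 0 j)^* else graph01 t (row i v) 0 j).
    by apply/funext => t; rewrite mxE; case: ifP => //; rewrite [LHS]mxE.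
  rewrite mxE; case: ifP => _; last exact: dgraph.
  rewrite [X in is_Cderive _ _ _ X]mxE; exact/is_Cderive_conj/dgraph.
have lin : \forall t \near (0 : R), multilinear (w t).
  by apply: filterS walt => t /alt_multilinearP[].
have D := multilinear_leibniz dw lin dB.
have Sp' : #|S| != p by rewrite -Sp neq_ltn leqnn.
have D0 : @is_Cderive R R 0 1 (fun t => w t (B t)) 0.
  apply: is_Cderive_near (is_Cderive_cst _ _ 0).
  apply: filterS2 wtype Hgraph => t wt Ht; apply/esym/(wt S) => // i iS.
    by rewrite rowB iS; apply: Ht; rewrite cjK; exact: v10.
  by rewrite rowB (negbTE iS); apply: Ht; exact: v01.
have := is_Cderive_unique D D0; rewrite B0 => /eqP.
rewrite addr_eq0 => /eqP ->; rewrite -sumrN; apply: eq_bigr => i _.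
rewrite rowB'; case: ifPn => iS; last first.
  have := multilinearZ i (-1) (X i) v wlin0.
  by rewrite scaleN1r mulN1r => ->; rewrite opprK.
rewrite XS //; apply/esym/eqP; rewrite oppr_eq0; apply/eqP.
apply: (w_pure0 (S := S :\ i)).
  split=> j; rewrite !inE; have [->|ji] /= := eqVneq j i => jS //.
  - by rewrite row_set_row_neq //; exact: v10.
  - rewrite row_set_row cjK -scaleN1r scaler_sumr.
    by under eq_bigr do rewrite scalerA; exact: std10_lincomb.
  - by rewrite row_set_row_neq //; exact: v01.
have := cardsD1 i S; rewrite iS -Sp => ->.
by rewrite neq_ltn add1n ltnS leqnSn.
Qed.

(** Both sides are multilinear and agree on vectors of pure type: weighting the
    pullback at the node [j] by one more factor [j] selects the component of
    type (p-1,p+1) instead of that of type (p,p). *)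
Lemma contraction_eq_component (c : 'I_k.+2 -> R[i]) :
  (forall s, (s <= k.+1)%N -> \sum_j c j * (j%:R) ^+ s = (s == p)%:R) ->
  contract_form f' (w 0) =
  (fun v => \sum_(j < k.+2) (c j * j%:R) * w' (v *m scale10 j%:R)).
Proof.
move=> cE.
have lin' : multilinear w'.
  apply: (multilinear_deriv dw).
  by apply: filterS walt => t /alt_multilinearP[].
apply: multilinear_ext_pure.
- exact: multilinear_contract_form.
- by apply: multilinear_lincomb => j; exact: multilinear_mulmx.
move=> S v Sv; rewrite (contraction_is_variation Sv).
under eq_bigr do
  rewrite (multilinear_scale10 _ lin' Sv) mulrA -(mulrA (c _)) -exprS.
rewrite -mulr_suml cE; last first.
  by rewrite ltnS -[X in (_ <= X)%N](card_ord k) max_card.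
by case: eqP; rewrite ?mul1r ?mul0r.
Qed.

End TypeVariation.
(** * The operators del and delbar *)

Section Dolbeault.
Context {R : realType} {n k : nat}.
Local Notation cj := (map_mx (@conjc R)).
Implicit Types (w : 'rV[R]_(n + n) -> covector R (n + n) k).

Lemma wedge_prod_lincomb m d e (I : finType) (a : covector R m d)
    (x : I -> R[i]) (b : I -> covector R m e) v :
  wedge_prod a (fun u => \sum_j x j * b j u) v =
  \sum_j x j * wedge_prod a (b j) v.
Proof.
rewrite /wedge_prod; under [RHS]eq_bigr do rewrite mulrCA mulr_sumr.
rewrite -mulr_sumr exchange_big; congr (_ * _).
apply: eq_bigr => s _; rewrite !mulr_sumr; apply: eq_bigr => j _.
by rewrite [X in _ * X = _]mulrCA [LHS]mulrCA.
Qed.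

Lemma wedge_prod_is_Cderive (a : covector R (n + n) 1)
    (b : R -> covector R (n + n) k) (b' : covector R (n + n) k) t v :
  (forall u, @is_Cderive R R t 1 (b ^~ u) (b' u)) ->
  @is_Cderive R R t 1 (fun s => wedge_prod a (b s) v) (wedge_prod a b' v).
Proof.
move=> db; apply: is_CderiveZ; apply: is_Cderive_sum => s.
by apply: is_CderiveZ; apply: is_CderiveZ.
Qed.

(** For [x] the components of a vector and [g] the partial derivatives of a
    function, both sides are the differential of the function at the vector. *)
Lemma complex_coordinates_sum (x g : 'I_(n + n) -> R[i]) :
  \sum_r x r * g r =
  \sum_l ((x (lshift n l) + 'i * x (rshift n l)) *
          (2%:R^-1 * (g (lshift n l) - 'i * g (rshift n l))) +
          (x (lshift n l) - 'i * x (rshift n l)) *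
          (2%:R^-1 * (g (lshift n l) + 'i * g (rshift n l)))).
Proof.
rewrite big_split_ord /= -big_split; apply: eq_bigr => l _ /=.
set a := x _; set b := x _; set c := g _; set d := g _.
rewrite -[RHS](_ : a * c - ('i * 'i) * (b * d) = _); last by field.
by rewrite i2E mulN1r opprK.
Qed.

Lemma ext_dE w x v : ext_d w x v = del w x v + delbar w x v.
Proof.
rewrite /ext_d /del /delbar /wedge_prod -!mulr_sumr -mulrDr; congr (_ * _).
rewrite exchange_big [X in _ = X + _]exchange_big [X in _ = _ + X]exchange_big.
rewrite -big_split; apply: eq_bigr => s _ /=.
rewrite -!mulr_sumr -mulrDr; congr (_ * _).
set v1 := usubmx _; set v2 := dsubmx _.
rewrite -big_split /=.
exact: (complex_coordinates_sum (fun r => v1 0 r)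
  (fun r => Cpartial r (fun y => w y v2) x)).
Qed.

Section Linearity.
Variables (U : set 'rV[R]_(n + n)) (x : 'rV[R]_(n + n)).
Hypothesis Ux : U x.

Lemma Cpartial_lincomb (I : finType) (c : I -> R[i])
    (f : I -> 'rV[R]_(n + n) -> R[i]) r :
  (forall j, Csmooth_on U (f j)) ->
  Cpartial r (fun y => \sum_j c j * f j y) x = \sum_j c j * Cpartial r (f j) x.
Proof.
move=> sf; apply: CpartialE; apply: is_Cderive_lincomb => j.
exact: Csmooth_is_Cderive (sf j) Ux.
Qed.

Lemma z_partial_lincomb (I : finType) (c : I -> R[i])
    (f : I -> 'rV[R]_(n + n) -> R[i]) l :
  (forall j, Csmooth_on U (f j)) ->
  z_partial l (fun y => \sum_j c j * f j y) x =
  \sum_j c j * z_partial l (f j) x.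
Proof.
move=> sf; rewrite /z_partial !Cpartial_lincomb // !mulr_sumr -sumrB mulr_sumr.
by apply: eq_bigr => j _; ring.
Qed.

Lemma zbar_partial_lincomb (I : finType) (c : I -> R[i])
    (f : I -> 'rV[R]_(n + n) -> R[i]) l :
  (forall j, Csmooth_on U (f j)) ->
  zbar_partial l (fun y => \sum_j c j * f j y) x =
  \sum_j c j * zbar_partial l (f j) x.
Proof.
move=> sf; rewrite /zbar_partial !Cpartial_lincomb // !mulr_sumr -big_split /=.
by rewrite mulr_sumr; apply: eq_bigr => j _; ring.
Qed.

Lemma delbar_lincomb (I : finType) (c : I -> R[i])
    (w : I -> 'rV[R]_(n + n) -> covector R (n + n) k) v :
  (forall j u, Csmooth_on U (fun y => w j y u)) ->
  delbar (fun y u => \sum_j c j * w j y u) x v = \sum_j c j * delbar (w j) x v.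
Proof.
move=> sw; rewrite /delbar; under [RHS]eq_bigr do rewrite mulr_sumr.
rewrite exchange_big; apply: eq_bigr => l _.
rewrite -wedge_prod_lincomb; congr (wedge_prod _ _ _); apply/funext => u.
by rewrite zbar_partial_lincomb.
Qed.

Lemma mulmx_blocks m d e (s : 'S_(d + e)) (v : 'M[R[i]]_(d + e, m))
    (A : 'M[R[i]]_m) :
  usubmx (row_perm s (v *m A)) = usubmx (row_perm s v) *m A /\
  dsubmx (row_perm s (v *m A)) = dsubmx (row_perm s v) *m A.
Proof.
split; apply/matrixP => i j; rewrite !mxE; apply: eq_bigr => l _;
  by rewrite !mxE.
Qed.

Variable w : 'rV[R]_(n + n) -> covector R (n + n) k.
Hypothesis sw : forall u, Csmooth_on U (fun y => w y u).

Lemma delbar_pullback (I : finType) (c z : I -> R[i]) v :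
  delbar (fun y u => \sum_j c j * w y (u *m scale10 (z j))) x v =
  \sum_j c j * delbar w x (v *m scale10 (z j)).
Proof.
apply: (etrans (@delbar_lincomb _ c
  (fun j y u => w y (u *m scale10 (z j))) v (fun j u => sw _))).
apply: eq_bigr => j _; congr (_ * _); apply: eq_bigr => l _.
congr (_ * _); apply: eq_bigr => s _; congr (_ * _).
have [-> ->] := mulmx_blocks s v (scale10 (z j)).
by have [_ ->] := scale10E (z j) (usubmx (row_perm s v)) l.
Qed.

(** The extra factor [z] in the weights is the one by which [dz] scales. *)
Lemma del_pullback (I : finType) (c z : I -> R[i]) v :
  del (fun y u => \sum_j (c j * z j) * w y (u *m scale10 (z j))) x v =
  \sum_j c j * del w x (v *m scale10 (z j)).
Proof.
rewrite /del; under [RHS]eq_bigr do rewrite mulr_sumr.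
rewrite exchange_big; apply: eq_bigr => l _.
have E u : z_partial l
    (fun y => \sum_j (c j * z j) * w y (u *m scale10 (z j))) x =
    \sum_j (c j * z j) * z_partial l (fun y => w y (u *m scale10 (z j))) x.
  exact: (@z_partial_lincomb _ (fun j => c j * z j)
    (fun j y => w y (u *m scale10 (z j)))).
rewrite (funext E).
apply: (etrans (wedge_prod_lincomb (dz l) (fun j => c j * z j)
  (fun j u => z_partial l (fun y => w y (u *m scale10 (z j))) x) v)).
apply: eq_bigr => j _.
rewrite -mulrA; congr (_ * _); rewrite /wedge_prod mulrCA; congr (_ * _).
rewrite mulr_sumr; apply: eq_bigr => s _; rewrite mulrCA; congr (_ * _).
have [-> ->] := mulmx_blocks s v (scale10 (z j)).
have [-> _] := scale10E (z j) (usubmx (row_perm s v)) l.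
by rewrite mulrA.
Qed.

Lemma del_near w1 w2 v : open U -> (forall y, U y -> w1 y = w2 y) ->
  del w1 x v = del w2 x v.
Proof.
move=> oU w12.
have E u r : Cpartial r (fun y => w1 y u) x = Cpartial r (fun y => w2 y u) x.
  by apply: Cpartial_near; apply: open_near oU Ux _ => y Uy; rewrite w12.
have Ez l : (fun u => z_partial l (fun y => w1 y u) x) =
            (fun u => z_partial l (fun y => w2 y u) x).
  by apply/funext => u; rewrite /z_partial !E.
by rewrite /del; under eq_bigr do rewrite Ez.
Qed.

End Linearity.

End Dolbeault.

(** * Jacobians in complex coordinates *)

Section Jacobian.
Context {R : realType} {n : nat}.
Local Notation cj := (map_mx (@conjc R)).
Local Notation push T x v := (v *m map_mx (real_complex R) ('J T x)).
Implicit Types (T : 'rV[R]_(n + n) -> 'rV[R]_(n + n)) (x : 'rV[R]_(n + n)).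

Lemma jacobianE T x r s : differentiable T x ->
  'J T x r s = 'D_('e_r) (fun y => T y 0 s) x.
Proof.
move=> dT; have dv := diff_derivable (v := 'e_r) dT.
have := derive_mx dv => /matrixP/(_ 0 s); rewrite [RHS]mxE => <-.
by rewrite deriveEjacobian // -rowE [RHS]mxE.
Qed.

(** The chain rule for the coordinates of the target. *)
Lemma dz_push T x (u : 'rV[R[i]]_(n + n)) j : differentiable T x ->
  dz j (push T x u) =
  \sum_l (dz l u * z_partial l (fun y => zcoord j (T y)) x +
          dzbar l u * zbar_partial l (fun y => zcoord j (T y)) x).
Proof.
move=> dT; have P r : Cpartial r (fun y => zcoord j (T y)) x =
    ('J T x r (lshift n j))%:C + 'i * ('J T x r (rshift n j))%:C.
  rewrite !jacobianE // /Cpartial /zcoord /=.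
  by apply/eqP; rewrite eq_complex /=; apply/andP; split; apply/eqP; ring.
transitivity (\sum_r u 0 r * Cpartial r (fun y => zcoord j (T y)) x).
  rewrite /dz !mxE mulr_sumr -big_split; apply: eq_bigr => r _ /=.
  by rewrite P !mxE; ring.
exact: complex_coordinates_sum.
Qed.

Lemma push_conj T x (u : 'rV[R[i]]_(n + n)) : push T x (cj u) = cj (push T x u).
Proof.
rewrite map_mxM; congr (_ *m _); move: ('J T x) => A.
by apply/matrixP => r s; rewrite !mxE /= oppr0.
Qed.

Lemma dzbar_push T x (u : 'rV[R[i]]_(n + n)) j :
  dzbar j (push T x u) = (dz j (push T x (cj u)))^*.
Proof. by rewrite push_conj dz_conj conjcK. Qed.

(** The differential of a holomorphic map preserves types. *)
Lemma push_scale10 T x z m (v : 'M[R[i]]_(m, n + n)) :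
  differentiable T x ->
  (forall l j, zbar_partial l (fun y => zcoord j (T y)) x = 0) ->
  push T x (v *m scale10 z) = push T x v *m scale10 z.
Proof.
move=> dT hol; apply/row_matrixP => i; rewrite !row_mul.
set u := row i v; apply: row_dz_ext => j.
  have [-> _] := scale10E z (push T x u) j.
  rewrite !dz_push // mulr_sumr; apply: eq_bigr => l _.
  by have [-> _] := scale10E z u l; rewrite hol; ring.
have [_ ->] := scale10E z (push T x u) j.
rewrite !dzbar_push !dz_push //; congr (_^*); apply: eq_bigr => l _.
rewrite !dz_conj hol; have [_ ->] := scale10E z u l.
by ring.
Qed.

End Jacobian.
(** * Charts *)

Section ChartFacts.
Context {R : realType} {M : topologicalType} {n : nat}.
Local Notation cchart := (chart R M (n + n)).
Local Notation cj := (map_mx (@conjc R)).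
Implicit Types (c d : cchart) (A B : set cchart).

Lemma chart_imgP c x : is_chart c -> chart_img c setT x ->
  chart_dom c (chart_bwd c x) /\ chart_fwd c (chart_bwd c x) = x.
Proof. by move=> [_ _ K _ _] [z [dz _] <-]; rewrite K. Qed.

Lemma overlapP c d x : is_chart c ->
  overlap c d x <-> chart_img c setT x /\ chart_dom d (chart_bwd c x).
Proof.
move=> ic; have [_ _ K _ _] := ic; split.
  by move=> [z [dz ddz] <-]; split; [exists z|rewrite K].
move=> [xc dx]; have [c1 c2] := chart_imgP ic xc.
by exists (chart_bwd c x).
Qed.

Lemma open_overlap c d : is_chart c -> is_chart d -> open (overlap c d).
Proof.
move=> ic id; have [_ oi _ _ cb] := ic; have [od _ _ _ _] := id.
have -> : overlap c d = chart_img c setT `&` chart_bwd c @^-1` chart_dom d.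
  by apply/seteqP; split=> x /overlapP -/(_ ic).
rewrite (continuous_open_subspace _ oi) in cb.
rewrite openE => x [xi xd]; apply: filterI; first exact: open_nbhs_nbhs.
by apply: (cb x); rewrite ?inE //; apply: open_nbhs_nbhs.
Qed.

Lemma smooth_on_coord m (U : set 'rV[R]_m) (T : 'rV[R]_m -> 'rV[R]_m) s :
  open U -> smooth_on U T -> smooth_on U (fun y => T y 0 s).
Proof.
move=> oU sT.
have E r : forall x, U x ->
    foldr (fun i g => 'D_('e_i) g) (fun y => T y 0 s) r x =
    (foldr (fun i g => 'D_('e_i) g) T r x) 0 s.
  elim: r => [//|i r IH] x Ux /=.
  rewrite (near_eq_derive _ (open_near oU Ux IH)) derive_mx ?mxE //.
  exact: diff_derivable (sT r x Ux).
move=> r x Ux; apply: (@near_eq_differentiable _ _ _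
  (fun y => (foldr (fun i g => 'D_('e_i) g) T r y) 0 s)).
  by apply: open_near oU Ux _ => y Uy; rewrite E.
apply: (@differentiable_comp _ _ _ _ _ (fun N : 'rV[R]_m => N 0 s)).
  exact: sT.
exact: differentiable_coord.
Qed.

Lemma smooth_zcoord c d j : is_chart c -> is_chart d -> smooth_transition c d ->
  Csmooth_on (overlap c d) (fun y => zcoord j (transition c d y)).
Proof.
move=> ic id st; have oo := open_overlap ic id.
by split; apply: smooth_on_coord.
Qed.

(** The chart [c] is among the charts of [A] that test membership in
    [T10 A c x], and its transition to itself is the identity. *)
Lemma T10_std A c x : complex_atlas A -> A c -> chart_img c setT x ->
  T10 A c x `<=` @std10 R n.
Proof.
move=> [chA _ hol] Ac xc v vH; have ic := chA c Ac.
have [_ oi _ _ _] := ic.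
have xo : overlap c c x.
  by apply/(overlapP _ _ ic); split=> //; have [] := chart_imgP ic xc.
have := vH c Ac xo; rewrite /pushforward_chart.
suff -> : 'J (transition c c) x = 1%:M by rewrite map_mx1 mulmx1.
have [st _] := hol c c Ac Ac; have dT := st [::] x xo.
apply/row_matrixP => i; rewrite !rowE -deriveEjacobian // mulmx1.
rewrite -[RHS](derive_id x); apply: near_eq_derive.
by apply: open_near oi xc _ => y /(chart_imgP ic)[].
Qed.

Lemma pure_T10 A c x k (S : {set 'I_k}) (v : 'M[R[i]]_(k, n + n)) :
  complex_atlas A -> A c -> chart_img c setT x ->
  (forall i, i \in S -> T10 A c x (row i v)) ->
  (forall i, i \notin S -> T10 A c x (cj (row i v))) -> pure S v.
Proof.
by move=> cA Ac xc h1 h2; split=> i iS; apply: (T10_std cA Ac xc); auto.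
Qed.

Lemma form_of_type_lincomb A p q k (b1 b2 : dform k) (s : R[i]) :
  complex_atlas A -> form_of_type A A p q b1 -> form_of_type A A p q b2 ->
  form_of_type A A p q (fun c x v => b1 c x v + s * b2 c x v).
Proof.
move=> [chA _ _] [[a1 s1 t1] ty1] [[a2 s2 t2] ty2].
have alt c x : A c -> chart_img c setT x ->
    alt_multilinear (fun v => b1 c x v + s * b2 c x v).
  move=> Ac xc; have /alt_multilinearP[l1 z1] := a1 c x Ac xc.
  have /alt_multilinearP[l2 z2] := a2 c x Ac xc.
  apply/alt_multilinearP; split.
    by move=> i u w v y z; rewrite l1 l2; ring.
  by move=> i j v ij vE; rewrite (z1 i j) // (z2 i j) // mulr0 addr0.
split; first split=> //.
- move=> c v Ac; have [_ oi _ _ _] := chA c Ac.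
  exact: Csmooth_onD (s1 c v Ac) (Csmooth_onZ _ oi (s2 c v Ac)).
- by move=> c d x v Ac Ad xo; rewrite (t1 c d) // (t2 c d).
move=> c x Ac xc; have [kE _ ty1'] := ty1 c x Ac xc.
have [_ _ ty2'] := ty2 c x Ac xc; split=> //; first exact: alt.
by move=> S v h1 h2 Sp; rewrite (ty1' S) // (ty2' S) // mulr0 addr0.
Qed.

(** Primitives for the two cosets differ by [b0]. *)
Lemma dolbeault_class_coboundary A p q k (w : dform (1 + k)) (b0 : dform k) :
  complex_atlas A -> form_of_type A A p q b0 ->
  form_eq A w (fun c => delbar (b0 c)) ->
  dolbeault_class A p q w = dolbeault_class A p q (fun _ _ _ => 0).
Proof.
move=> cA tb0 wE; have [chA _ _] := cA.
have step (s : R[i]) b c x v : form_of_type A A p q b -> A c ->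
    chart_img c setT x ->
    delbar (fun y u => b c y u + s * b0 c y u) x v =
    delbar (b c) x v + s * delbar (b0 c) x v.
  move=> [[_ sb _] _] Ac xc; have [[_ sb0 _] _] := tb0.
  pose e (j : bool) : R[i] := if j then 1 else s.
  pose w' (j : bool) : dform k := if j then b else b0.
  have := @delbar_lincomb _ _ _ _ _ xc bool e (fun j => w' j c) v.
  rewrite big_bool /= mul1r => <-.
    rewrite (_ : (fun y u => \sum_j e j * w' j c y u) =
      (fun y u => b c y u + s * b0 c y u)) //.
    by apply/funext => y; apply/funext => u; rewrite big_bool /= mul1r.
  by move=> [] u; [exact: sb|exact: sb0].
apply/seteqP; split=> a [ta da [b tb ab]]; split=> //.
  exists (fun c x v => b c x v + (- 1) * b0 c x v).
    exact: form_of_type_lincomb.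
  by move=> c x v Ac xc; rewrite step // -ab // wE //; ring.
exists (fun c x v => b c x v + 1 * b0 c x v).
  exact: form_of_type_lincomb.
by move=> c x v Ac xc; rewrite step // -ab // wE //; ring.
Qed.

End ChartFacts.
(** * The deformation in a chart *)

Section Deformation.
Context {R : realType} {M : topologicalType} {n : nat}.
Local Notation cj := (map_mx (@conjc R)).
Variables (J : set (chart R M (n + n))) (eps : R).
Variables (Jt : R -> set (chart R M (n + n))) (phi : R -> @vform R M n).
Hypothesis cJ : complex_atlas J.
Hypothesis eps0 : 0 < eps.
Hypothesis fam : differentiable_family J eps Jt.
Hypothesis par : parametrizes J eps Jt phi.

Local Notation I := (`]- eps, eps[%classic : set R).

Lemma near_param : \forall t \near (0 : R), I t.
Proof.
by apply: open_nbhs_nbhs; split; [exact: interval_open|exact: zero_in_param].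
Qed.

(** A (0,1)-vector of [Jt t] is one that kills the holomorphic coordinates of
    [Jt t]; the equation that the vector form imposes on holomorphic functions
    says that these coordinates are killed by the corrected vectors. *)
Lemma T10_graph t c x (u : 'rV[R[i]]_(n + n)) :
  I t -> J c -> chart_img c setT x -> std10 (cj u) ->
  T10 (Jt t) c x (cj (graph01 (fun s => phi s c x) t u)).
Proof.
move=> It Jc xc u01 d Jd xo.
have [cm sc _] := fam; have [_ _ [chJt _ holJt]] := cm t It.
have [chJ _ _] := cJ; have ic := chJ c Jc; have id := chJt d Jd.
have dT : differentiable (transition c d) x := (sc t It c d Jc Jd).1 [::] x xo.
rewrite /pushforward_chart push_conj; apply/std01P => j.
have [_ _ _ _ hol] := par.
have od : open (chart_dom d) by have [] := id.
have sm : smooth_fun J (chart_dom d) (fun z => zcoord j (chart_fwd d z)).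
  move=> c' Jc'; apply: smooth_zcoord => //; first exact: chJ.
  exact: (sc t It c' d Jc' Jd).1.
have hf : holomorphic_fun (Jt t) (chart_dom d)
    (fun z => zcoord j (chart_fwd d z)).
  move=> c' Jc'; have [st zb] := holJt c' d Jc' Jd.
  split; last by move=> y l yo; exact: zb.
  by apply: smooth_zcoord => //; exact: chJt.
have := (hol t _ _ It od sm).1 hf c x u Jc xo.
rewrite dz_push // => E; rewrite -[RHS]E -sumrB; apply: eq_bigr => l _.
have dzg : dz l (graph01 (fun s => phi s c x) t u) = - phi t c x l u.
  rewrite /graph01 -scaleN1r dzD dzZ dz_lincomb.
  have /std01P -> := u01; rewrite add0r mulN1r; congr (- _).
  rewrite -[RHS](sum_delta (fun l => phi t c x l u)); apply: eq_bigr => r _.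
  by have [-> _ _ _] := dz_dual (R := R) r l.
have dzbg : dzbar l (graph01 (fun s => phi s c x) t u) = dzbar l u.
  rewrite /graph01 -scaleN1r dzbarD dzbarZ dzbar_lincomb big1 ?mulr0 ?addr0 //.
  by move=> r _; have [_ -> _ _] := dz_dual (R := R) r l; rewrite mulr0.
by rewrite dzg dzbg; ring.
Qed.

Lemma vform_deriv_is_Cderive c x l v : J c -> chart_img c setT x ->
  @is_Cderive R R 0 1 (fun t => phi t c x l v) (vform_deriv phi 0 c x l v).
Proof.
move=> Jc xc; have [_ sm _ _ _] := par.
exact: (family_is_Cderive (sm c l v Jc) (zero_in_param eps0) xc).
Qed.

Lemma vector_form_std10 t c x l u : I t -> J c -> chart_img c setT x ->
  std10 u -> phi t c x l u = 0.
Proof.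
move=> It Jc xc u10; have [vf _ _ _ _] := par; have [ty _ _] := vf t It.
have [_ _ /(_ finset.setT)] := ty c x l Jc xc; apply.
- move=> i _; rewrite (_ : row i u = u) //.
  by apply/rowP => r; rewrite mxE ord1.
- by move=> i; rewrite inE.
- by rewrite cardsT card_ord.
Qed.

Section Forms.
Variables (p : nat) (Omegat : R -> @dform R M n (p + p)).
Hypothesis smO : smooth_form_family J eps Omegat.
Hypothesis kO : forall t, I t -> p_kahler J (Jt t) (Omegat t).

Definition form_deriv : @dform R M n (p + p) :=
  fun c x v => Cderiv (fun t => Omegat t c x v) 0.

Lemma form_deriv_is_Cderive c x v : J c -> chart_img c setT x ->
  @is_Cderive R R 0 1 (fun t => Omegat t c x v) (form_deriv c x v).
Proof.
move=> Jc xc; have [_ sm] := smO.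
exact: (family_is_Cderive (sm c v Jc) (zero_in_param eps0) xc).
Qed.

Lemma near_alt c x : J c -> chart_img c setT x ->
  \forall t \near (0 : R), alt_multilinear (Omegat t c x).
Proof.
move=> Jc xc; apply: filterS near_param => t It.
by have [s _] := smO; have [alt _ _] := s t It; apply: alt.
Qed.

Lemma alt_form_deriv c x : J c -> chart_img c setT x ->
  alt_multilinear (form_deriv c x).
Proof.
move=> Jc xc; apply: alt_multilinear_deriv (near_alt Jc xc) => v.
exact: form_deriv_is_Cderive.
Qed.

Lemma smooth_form_deriv c v : J c ->
  Csmooth_on (chart_img c setT) (fun x => form_deriv c x v).
Proof.
by move=> Jc; have [_ sm] := smO; exact: (family_deriv_smooth eps0 (sm c v Jc)).
Qed.

(** The derivatives in the parameter and along the manifold commute. *)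
Lemma closed_form_deriv : closed_form J form_deriv.
Proof.
move=> c x v Jc xc; have [chJ _ _] := cJ; have [_ oi _ _ _] := chJ c Jc.
have [_ sm] := smO.
have D : @is_Cderive R R 0 1 (fun t => ext_d (Omegat t c) x v)
                             (ext_d (form_deriv c) x v).
  apply: is_Cderive_sum => j; apply: wedge_prod_is_Cderive => u.
  exact: (family_mixed eps0 oi (sm c u Jc) j xc).
apply: is_Cderive_unique D _; apply: is_Cderive_near (is_Cderive_cst _ _ 0).
apply: filterS near_param => t It.
by have [_ _ /(_ c x v Jc xc) -> _] := kO It.
Qed.

Variable wt : 'I_(p + p).+2 -> R[i].
Hypothesis wtE : forall s, (s <= (p + p).+1)%N ->
  \sum_j wt j * (j%:R) ^+ s = (s == p)%:R.

(** Minus the component of type (p,p) of the derivative, see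
    [multilinear_scale10]. *)
Definition potential : @dform R M n (p + p) :=
  fun c x v => \sum_j (- wt j) * form_deriv c x (v *m scale10 j%:R).

Lemma contract_form_deriv c x : J c -> chart_img c setT x ->
  contract_form (vform_deriv phi 0 c x) (Omegat 0 c x) =
  (fun v => \sum_j (wt j * j%:R) * form_deriv c x (v *m scale10 j%:R)).
Proof.
move=> Jc xc; have [vf _ phi0 _ _] := par.
apply: (contraction_eq_component (p := p) (H := fun t => T10 (Jt t) c x)
  (w := fun t => Omegat t c x) (f := fun t => phi t c x)) => //.
- by move=> v; exact: form_deriv_is_Cderive.
- by move=> l u; exact: vform_deriv_is_Cderive.
- exact: near_alt.
- apply: filterS near_param => t It.
  have [[_ ty] _ _ _] := kO It.
  by have [_ _ ty'] := ty c x Jc xc; exact: ty'.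
- by apply: filterS near_param => t It u; exact: T10_graph.
- by move=> l u; exact: phi0.
- move=> l u u10; apply: is_Cderive_unique (vform_deriv_is_Cderive l u Jc xc) _.
  apply: is_Cderive_near (is_Cderive_cst _ _ 0).
  by apply: filterS near_param => t It; rewrite vector_form_std10.
- move=> l; apply: (multilinear_deriv
    (fun v => vform_deriv_is_Cderive l v Jc xc)).
  apply: filterS near_param => t It.
  have [ty _ _] := vf t It; have [_ alt _] := ty c x l Jc xc.
  by have [] := (alt_multilinearP _).1 alt.
Qed.

Lemma potential_type : form_of_type J J p p potential.
Proof.
have [chJ _ hol] := cJ; have [sO _] := smO.
have alt c x : J c -> chart_img c setT x -> alt_multilinear (potential c x).
  move=> Jc xc; apply: alt_multilinear_lincomb => j.
  exact/alt_multilinear_mulmx/alt_form_deriv.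
split; first split.
- exact: alt.
- move=> c v Jc; have [_ oi _ _ _] := chJ c Jc.
  apply: (Csmooth_on_lincomb (fun j => - wt j)
    (f := fun j x => form_deriv c x (v *m scale10 j%:R))) => // j.
  exact: smooth_form_deriv.
- move=> c d x v Jc Jd xo; have [st zb] := hol c d Jc Jd.
  have dT : differentiable (transition c d) x := st [::] x xo.
  apply: eq_bigr => j _; congr (_ * _).
  have P : pushforward_chart c d x (v *m scale10 j%:R) =
      pushforward_chart c d x v *m scale10 j%:R.
    by apply: push_scale10 dT _ => l r; exact: zb.
  have [xc dx] := (overlapP d x (chJ c Jc)).1 xo.
  have xd : chart_img d setT (transition c d x) by exists (chart_bwd c x).
  rewrite -P; apply: is_Cderive_unique (form_deriv_is_Cderive _ Jc xc) _.
  apply: is_Cderive_near (form_deriv_is_Cderive _ Jd xd).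
  apply: filterS near_param => t It.
  by have [_ _ tr] := sO t It; rewrite (tr c d).
move=> c x Jc xc; split; [by []|exact: alt|].
move=> S v h1 h2 Sp; have Sv := pure_T10 cJ Jc xc h1 h2.
have [lin _] := (alt_multilinearP _).1 (alt_form_deriv Jc xc).
rewrite /potential.
under eq_bigr do rewrite (multilinear_scale10 _ lin Sv) mulrA mulNr.
rewrite -mulr_suml sumrN wtE ?(negbTE Sp) ?oppr0 ?mul0r //.
by apply: leqW; rewrite -[X in (_ <= X)%N](card_ord (p + p)) max_card.
Qed.

(** On the weighted pullbacks, [del] of the component of type (p-1,p+1) and
    [delbar] of that of type (p,p) add up to pullbacks of the exterior
    derivative of a closed form. *)
Lemma del_contract_form c x v : J c -> chart_img c setT x ->
  del (fun y => contract_form (vform_deriv phi 0 c y) (Omegat 0 c y)) x v =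
  delbar (potential c) x v.
Proof.
move=> Jc xc; have [chJ _ _] := cJ; have [_ oi _ _ _] := chJ c Jc.
rewrite (del_near (w2 := fun y u =>
    \sum_j (wt j * j%:R) * form_deriv c y (u *m scale10 j%:R)) xc v oi).
  rewrite (del_pullback xc (w := form_deriv c)
    (fun u => smooth_form_deriv u Jc) wt (fun j => j%:R)).
  rewrite (delbar_pullback xc (w := form_deriv c)
    (fun u => smooth_form_deriv u Jc) (fun j => - wt j) (fun j => j%:R)).
  apply/eqP; rewrite -subr_eq0 -sumrB; apply/eqP/big1 => j _.
  by rewrite mulNr opprK -mulrDr -ext_dE closed_form_deriv ?mulr0.
by move=> y yc; exact: contract_form_deriv.
Qed.

End Forms.

End Deformation.
Theorem corollary1p4 (R : realType) (n p : nat) (M : topologicalType)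
    (J : set (chart R M (n + n)))
    (Omega : dform (n := n) (p + p))
    (eps : R)
    (Jt : R -> set (chart R M (n + n)))
    (phi : R -> vform (n := n))
    (Omegat : R -> dform (n := n) (p + p)) :
  complex_manifold J ->
  compact [set: M] ->
  (1 < p < n - 1)%N ->
  p_kahler J J Omega ->
  0 < eps ->
  differentiable_family J eps Jt ->
  Jt 0 = J ->
  parametrizes J eps Jt phi ->
  smooth_form_family J eps Omegat ->
  (forall t, `]- eps, eps[%classic t -> p_kahler J (Jt t) (Omegat t)) ->
  form_eq J (Omegat 0) Omega ->
  dolbeault_class J p p
    (fun c => del (fun x => contract_form (vform_deriv phi 0 c x) (Omega c x))) =
  dolbeault_class J p p (fun _ _ _ => 0).
Proof.
move=> [_ _ cJ] _ _ _ eps0 fam _ par smO kO OE.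
have [wt wtE] : exists wt : 'I_(p + p).+2 -> R[i], forall s,
    (s <= (p + p).+1)%N -> \sum_j wt j * (j%:R) ^+ s = (s == p)%:R.
  by apply: interpolation_weights; apply: leqW; exact: leq_addr.
apply: (dolbeault_class_coboundary cJ (potential_type cJ eps0 smO wtE)).
move=> c x v Jc xc; have [chJ _ _] := cJ; have [_ oi _ _ _] := chJ c Jc.
rewrite -(del_contract_form cJ eps0 fam par smO kO wtE v Jc xc).
apply: (del_near xc v oi) => y yc; congr (contract_form _ _).
by apply/funext => u; rewrite OE.
Qed.
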